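(* There exist symmetric constant-multiplicity hyperbolic systems of conservation laws in two space variables $$\partial_t U+\partial_{x_1}F_1(U)+\partial_{x_2}F_2(U)=0,\qquad U\in\mathcal U\subset\mathbb R^n,\ n\ge 2,$$ with a Métivier convex mode $\Lambda$ such that for any sufficiently small Laxian shock wave $(U^-,U^+)$ (of speed $0$, with discontinuity at $x_1=0$) associated with that mode, the Kreiss–Majda Lopatinski determinant $\Delta$ of the shock wave satisfies $$\Delta(i\sigma,\xi)=0\quad\text{for some }\sigma,\xi\in\mathbb R\text{ with }\sigma^2+\xi^2=1.$$ Here ''for any sufficiently small shock wave associated with that mode'' means the following. There is a state $U_*\in\mathcal U$ at which the mode has zero speed in the direction $N=(1,0)^\top$, i.e. $\Lambda(U_*,N,0)=0$, and there is $\varepsilon>0$ such that the assertion holds for every Laxian shock wave of speed $0$ associated with $\Lambda$ whose states satisfy $|U^\pm-U_*|<\varepsilon$.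
   Context: **Systems.** $F_1,F_2:\mathcal U\to\mathbb R^n$ are smooth maps on an open set $\mathcal U\subset\mathbb R^n$. For $N=(N_1,N_2)^\top\in\mathbb R^2$ write $FN=N_1F_1+N_2F_2$. The system is *symmetric* if the Jacobians $DF_1(U)$ and $DF_2(U)$ are symmetric matrices for all $U\in\mathcal U$. It is *constant-multiplicity hyperbolic* if, for all $U\in\mathcal U$ and $N\neq0$, the matrix $D(FN)(U)$ is diagonalizable over $\mathbb R$ and the multiplicities of its eigenvalues do not depend on $(U,N)$. **Modes.** A simple mode $\Lambda=\Lambda(U,N,\xi)$ is a smooth function giving a simple eigenvalue of $D(FN)(U)+\xi\,D(FN^\perp)(U)$, where $N$ is a unit vector, $N^\perp$ is a unit vector orthogonal to $N$, and $\xi\in\mathbb R$. For $N=(1,0)^\top$ it is an eigenvalue of $DF_1(U)+\xi DF_2(U)$. Eigenvalues are ordered increasingly and counted with multiplicity, and $p$ denotes the index of the mode, so $\Lambda$ is the $p$-th eigenvalue. **Métivier convexity.** A simple mode $\Lambda$ is called *Métivier convex* if, for $U\in\mathcal U$ and the propagation direction $N=(1,0)^\top$ of the shock waves considered: (a) (genuine nonlinearity) the row vector $D_U\Lambda(U,N,0)$ does not belong to the left image $\{w^\top(D(FN)(U)-\Lambda(U,N,0)I): w\in\mathbb R^n\}$ of $D(FN)(U)-\Lambda(U,N,0)I$; and (b) $D_\xi^2\Lambda(U,N,0)>0$. **Shock waves.** A Laxian shock wave of speed $0$ associated with the mode $\Lambda$ (a $p$-shock) is the piecewise constant function $U(x,t)=U^-$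 for $x_1<0$, $U(x,t)=U^+$ for $x_1>0$, with $U^-\neq U^+$, satisfying the Rankine–Hugoniot condition $F_1(U^+)=F_1(U^-)$ and the Lax conditions: writing $\lambda_1(U)\le\dots\le\lambda_n(U)$ for the eigenvalues of $DF_1(U)$, $$\lambda_{p-1}(U^-)<0<\lambda_p(U^-),\qquad \lambda_p(U^+)<0<\lambda_{p+1}(U^+)$$ (conditions involving $\lambda_0$ or $\lambda_{n+1}$ being void). In particular $DF_1(U^\pm)$ are invertible. **Lopatinski determinant.** Let $S=\{(\tau,\xi)\in\mathbb C\times\mathbb R:\ \operatorname{Re}\tau\ge0,\ |\tau|^2+\xi^2=1\}$, $F^\xi=\xi F_2$, and write $[h(U)]=h(U^+)-h(U^-)$. Put $$A^\mp(\tau,\xi)=(\tau I+i\,DF^\xi(U^\mp))\,(DF_1(U^\mp))^{-1}.$$ For $(\tau,\xi)\in S$ with $\operatorname{Re}\tau>0$ let $E^-(\tau,\xi)$ be the stable space of $A^-(\tau,\xi)$ (the sum of generalized eigenspaces for eigenvalues with negative real part), of dimension $p-1$, and let $E^+(\tau,\xi)$ be the unstable space of $A^+(\tau,\xi)$ (the sum of generalized eigenspaces for eigenvalues with positive real part), of dimension $n-p$. These spaces extend continuously to all of $S$, and the extensions are denoted by the same symbols. Let $\{R_1^-,\dots,R_{p-1}^-\}$ and $\{R_{p+1}^+,\dots,R_n^+\}$ be continuous bases on $S$ of $E^-$ and $E^+$ respectively. Then $$\Delta(\tau,\xi)=\det\bigl(R_1^-(\tau,\xi),\dots,R_{p-1}^-(\tau,\xi),\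 \tau[U]+i[F^\xi(U)],\ R_{p+1}^+(\tau,\xi),\dots,R_n^+(\tau,\xi)\bigr),\qquad(\tau,\xi)\in S.$$ Whether $\Delta$ vanishes at a given point does not depend on the choice of bases. *)

(* Defs.v *)
From HB Require Import structures.
From mathcomp Require Import all_boot all_order all_algebra.
From mathcomp Require Import complex.
From mathcomp Require Import boolp classical_sets reals topology normedtype.
From mathcomp Require Import derive trigo.

Set Implicit Arguments.
Unset Strict Implicit.
Unset Printing Implicit Defensive.

Import Order.TTheory GRing.Theory Num.Theory numFieldNormedType.Exports.

Local Open Scope classical_set_scope.
Local Open Scope ring_scope.

Fixpoint Ck_on (R : realType) (V W : normedModType R) (k : nat) (A : set V)
    (f : V -> W) : Prop :=
  match k with
  | 0%N => forall x, A x -> {for x, continuous f}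
  | k'.+1 => (forall x, A x -> differentiable f x) /\
             (forall v, Ck_on k' A ('D_v f))
  end.

Definition smooth_on (R : realType) (V W : normedModType R) (A : set V)
    (f : V -> W) : Prop := forall k, Ck_on k A f.

(* All the eigenvalues of A are real, and s lists them in increasing order,
   repeated according to multiplicity. *)
Definition ordered_eigenvalues (R : realType) (n : nat) (A : 'M[R]_n)
    (s : seq R) : Prop :=
  sorted <=%R s /\ char_poly A = \prod_(a <- s) ('X - a%:P).

Section Systems.

Variables (R : realType) (n : nat).
Implicit Types (F : 'rV[R]_n -> 'rV[R]_n) (N : R * R) (D : set 'rV[R]_n).

(* States are row vectors. The library's jacobian acts on row vectors from the
   right, so DF, with entries dF_i/dU_j, is its transpose. *)
Definition DF F (U : 'rV[R]_n) : 'M[R]_n := (jacobian F U)^T.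

Definition flux F1 F2 N (U : 'rV[R]_n) : 'rV[R]_n :=
  N.1 *: F1 U + N.2 *: F2 U.

Definition perp N : R * R := (- N.2, N.1).

Definition e1 : R * R := (1, 0).

Definition symmetric_system F1 F2 D : Prop :=
  forall U, D U -> (DF F1 U)^T = DF F1 U /\ (DF F2 U)^T = DF F2 U.

(* mult lists the multiplicities of the distinct eigenvalues, in increasing
   order of the eigenvalues. *)
Definition constant_multiplicity_hyperbolic F1 F2 D : Prop :=
  exists mult : seq nat, forall U N, D U -> N != (0, 0) ->
    diagonalizable (DF (flux F1 F2 N) U) /\
    exists2 s : seq R, ordered_eigenvalues (DF (flux F1 F2 N) U) s &
      [seq count_mem a s | a <- undup s] = mult.

Definition symbol F1 F2 (U : 'rV[R]_n) N (xi : R) : 'M[R]_n :=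
  DF (flux F1 F2 N) U + xi *: DF (flux F1 F2 (perp N)) U.

(* The index p is 0-based. Lam U N xi is only meaningful for N on the unit
   circle, so smoothness in N is smoothness in the angle of N. *)
Definition simple_mode F1 F2 D (p : 'I_n)
    (Lam : 'rV[R]_n -> R * R -> R -> R) : Prop :=
  smooth_on [set x : 'rV[R]_n * R * R | D x.1.1]
    (fun x => Lam x.1.1 (cos x.1.2, sin x.1.2) x.2) /\
  forall U N xi, D U -> N.1 ^+ 2 + N.2 ^+ 2 = 1 ->
    exists2 s : seq R, ordered_eigenvalues (symbol F1 F2 U N xi) s &
      s`_p = Lam U N xi /\ count_mem (Lam U N xi) s = 1%N.

Definition gradient (f : 'rV[R]_n -> R) (U : 'rV[R]_n) : 'rV[R]_n :=
  \row_j 'D_(delta_mx 0 j) f U.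

Definition Metivier_convex F1 F2 D (Lam : 'rV[R]_n -> R * R -> R -> R) : Prop :=
  forall U, D U ->
    ~ (exists w : 'rV[R]_n,
         gradient (fun V => Lam V e1 0) U =
         w *m (DF (flux F1 F2 e1) U - (Lam U e1 0)%:M)) /\
    0 < ((Lam U e1)^`(2))%classic 0.

(* Since p is 0-based, lambda_{p-1} and lambda_{p+1} are absent when p = 0
   and p.+1 = n respectively. *)
Definition laxian_shock F1 D (p : 'I_n) (Um Up : 'rV[R]_n) : Prop :=
  D Um /\ D Up /\ Um <> Up /\ F1 Up = F1 Um /\
  (exists2 s : seq R, ordered_eigenvalues (DF F1 Um) s &
     ((0 < p)%N -> s`_p.-1 < 0) /\ 0 < s`_p) /\
  (exists2 s : seq R, ordered_eigenvalues (DF F1 Up) s &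
     s`_p < 0 /\ ((p.+1 < n)%N -> 0 < s`_p.+1)).

End Systems.

Section Lopatinski.

Variables (R : realType) (n : nat).

(* R[i] itself carries no topology in the library; R[i]^o has the one given by
   the modulus. *)
Local Notation C := (R[i]^o).
Local Notation iC := (Complex 0 1 : C).
Local Notation toC := (map_mx (real_complex R)).
Implicit Types (F : 'rV[R]_n -> 'rV[R]_n) (U : 'rV[R]_n) (z : C * R).

Definition hemisphere : set (C * R) :=
  [set z | 0 <= complex.Re z.1 /\
           complex.Re z.1 ^+ 2 + complex.Im z.1 ^+ 2 + z.2 ^+ 2 = 1].

Definition generalized_eigenspace (A : 'M[C]_n) (a : C) : {vspace 'cV[C]_n} :=
  lker (linfun (mulmx ((A - a%:M) ^+ n) : 'cV[C]_n -> 'cV[C]_n)).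

Definition complex_eigenvalues (A : 'M[C]_n) : seq R[i] :=
  sval (closed_field_poly_normal (char_poly A : {poly R[i]})).

Definition stable_space (A : 'M[C]_n) : {vspace 'cV[C]_n} :=
  (\sum_(a <- complex_eigenvalues A | (complex.Re a < 0)%R)
     generalized_eigenspace A a)%VS.

Definition unstable_space (A : 'M[C]_n) : {vspace 'cV[C]_n} :=
  (\sum_(a <- complex_eigenvalues A | (0 < complex.Re a)%R)
     generalized_eigenspace A a)%VS.

Definition lopatinski_matrix F1 F2 U z : 'M[C]_n :=
  (z.1%:M + iC *: toC (DF (fun V => z.2 *: F2 V) U)) *m
  invmx (toC (DF F1 U)).

(* Continuity of a field of subspaces, as a map into the Grassmannian: near
   each point it is spanned by a continuous frame. *)
Definition continuous_subspaces (E : C * R -> {vspace 'cV[C]_n}) : Prop :=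
  forall z0, hemisphere z0 ->
    exists (O : set (C * R)) (k : nat) (b : 'I_k -> C * R -> 'cV[C]_n),
      [/\ open O, O z0,
          (forall j, {within hemisphere `&` O, continuous (b j)}) &
          (forall z, hemisphere z -> O z ->
             basis_of (E z) [seq b j z | j <- enum 'I_k])].

(* E is the continuous extension to the closed hemisphere of the field E0,
   given where Re tau > 0; it is unique on the hemisphere. *)
Definition continuous_extension (E0 E : C * R -> {vspace 'cV[C]_n}) : Prop :=
  (forall z, hemisphere z -> 0 < complex.Re z.1 -> E z = E0 z) /\
  continuous_subspaces E.

Definition continuous_basis (E : C * R -> {vspace 'cV[C]_n}) (J : pred 'I_n)
    (r : 'I_n -> C * R -> 'cV[C]_n) : Prop :=
  (forall j, J j -> {within hemisphere, continuous (r j)}) /\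
  (forall z, hemisphere z -> basis_of (E z) [seq r j z | j <- enum J]).

(* With the 0-based index p, E^- has basis (rm j), j < p, and E^+ has basis
   (rp j), p < j; the remaining vectors of rm and rp are irrelevant. *)
Definition lopatinski_bases F1 F2 (p : 'I_n) (Um Up : 'rV[R]_n)
    (rm rp : 'I_n -> C * R -> 'cV[C]_n) : Prop :=
  exists Em Ep : C * R -> {vspace 'cV[C]_n},
    continuous_extension
      (fun z => stable_space (lopatinski_matrix F1 F2 Um z)) Em /\
    continuous_extension
      (fun z => unstable_space (lopatinski_matrix F1 F2 Up z)) Ep /\
    continuous_basis Em [pred j : 'I_n | (j < p)%N] rm /\
    continuous_basis Ep [pred j : 'I_n | (p < j)%N] rp.

Definition lopatinski_jump F2 (Um Up : 'rV[R]_n) z : 'cV[C]_n :=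
  z.1 *: toC (Up - Um)^T + iC *: toC (z.2 *: F2 Up - z.2 *: F2 Um)^T.

Definition lopatinski_det F2 (p : 'I_n) (Um Up : 'rV[R]_n)
    (rm rp : 'I_n -> C * R -> 'cV[C]_n) z : C :=
  \det (\matrix_(i, j)
    (if (j < p)%N then rm j z
     else if j == p then lopatinski_jump F2 Um Up z
     else rp j z) i 0).

End Lopatinski.

(* Main.v *)
Require Import Defs.
From mathcomp Require Import all_boot all_order all_algebra.
From mathcomp Require Import complex.
From mathcomp Require Import boolp classical_sets functions reals topology normedtype.
From mathcomp Require Import landau derive realfun trigo.
From mathcomp Require Import ring lra.

Set Implicit Arguments.
Unset Strict Implicit.
Unset Printing Implicit Defensive.

Import Order.TTheory GRing.Theory Num.Theory numFieldNormedType.Exports.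
Local Open Scope classical_set_scope.
Local Open Scope ring_scope.

(** The example decouples into two blocks of size two, so that the Lopatinski
    determinant splits into a factor for each of them, and the factor of one
    block vanishes whatever the shock is.

    On the states with |u| < 1, where U = (u, v, w, z), the blocks are

      u_t + (u^2/2)_x + v_y = 0,      w_t + 3 w_x + 3 z_y = 0,
      v_t -     v_x  + u_y = 0,       z_t - 3 z_x + 3 w_y = 0.

    The first one carries the shock. In the direction (1, 0) its upper
    characteristic speed is u, which is genuinely nonlinear, and in the
    direction (1, xi) it is (u - 1)/2 + sqrt (((u + 1)/2)^2 + xi^2), a strictly
    convex function of xi. The second block is a wave system with speeds
    -3|N| and 3|N|; these enclose the speeds of the first block, so the
    whole system is strictly hyperbolic ([spectrum_sorted]), and the convex
    mode is the third of four: it has a wave mode on either side.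

    A shock of this mode changes only the component u, which is positive on the
    left and negative on the right ([laxian_shock_ex]). The wave block is linear
    and the same on both sides. It contributes to E^- its decaying normal mode,
    with eigenvalue -omega, and to E^+ its growing one, with eigenvalue omega, where
    omega^2 = tau^2/9 + xi^2. These modes are independent when Re tau > 0, but
    at the glancing frequency tau = 3 i xi both eigenvalues are 0 and the
    modes coincide. Then a column from E^- and a column from E^+ are
    dependent, and the determinant is zero ([lopatinski_det_glancing]).

    The spaces at the glancing frequency are only known as limits from the
    region Re tau > 0. The explicit normal modes, of the form
    (i xi, s tau + omega) and (s tau + omega, i xi), extend continuously to the
    whole hemisphere once omega is taken as a product of two principal roots
    ([omega]); this gives continuous bases ([lopatinski_bases_ex]). For
    arbitrary continuous bases, membership of the wave modes in E^- and E^+ is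
    expressed by the vanishing of determinants, and these relations pass to the
    limit ([stable_limit], [unstable_limit]). *)

(** * Maps of class C^k *)

Section Ck.
Variable R : realType.
Implicit Types V W : normedModType R.

(** Differentiability is a property of germs: the differential of f serves for
    g as well. *)
Lemma near_eq_differentiable V W (f g : V -> W) x :
  (\near x, f x = g x) -> differentiable f x -> differentiable g x.
Proof.
move=> fg df; have fgx : f x = g x by exact: nbhs_singleton fg.
have [dfc /eqaddoP fo] := (diff_locallyP x f).1 df.
have go : g \o shift x = cst (g x) + 'd f x +o_ 0 id.
  have fg0 : \forall y \near 0, f (y + x) = g (y + x).
    by move: fg; rewrite (near_shift 0 x) subr0.
  apply/eqaddoP => e e0; near=> y.
  have <- : (f \o shift x - (cst (f x) + 'd f x)) y =
            (g \o shift x - (cst (g x) + 'd f x)) y.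
    rewrite !fctE /= fgx; congr (_ - _); near: y.
    exact: fg0.
  near: y; exact: fo.
apply/diff_locallyP; rewrite (diff_unique dfc go).
Unshelve. all: by end_near. Qed.

(** The rules of calculus give derivatives by formulas that hold only on A; that
    A is open lets such a formula replace the derivative in the recursion. *)
Lemma Ck_eq V W k (A : set V) (f g : V -> W) : open A ->
  (forall x, A x -> f x = g x) -> Ck_on k A f -> Ck_on k A g.
Proof.
move=> oA; elim: k f g => [|k IH] f g fg /=.
  move=> cf x Ax; rewrite /prop_for /continuous_at -(fg x Ax).
  apply: cvg_trans (cf x Ax); apply: near_eq_cvg.
  by apply: filterS (open_nbhs_nbhs (conj oA Ax)).
have nfg x : A x -> \near x, f x = g x.
  by move=> Ax; apply: filterS (open_nbhs_nbhs (conj oA Ax)).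
move=> [df ckf]; split=> [x Ax|v].
  exact: near_eq_differentiable (nfg x Ax) (df x Ax).
by apply: IH (ckf v) => x Ax; exact: near_eq_derive (nfg x Ax).
Qed.

Lemma Ck_pred V W k (A : set V) (f : V -> W) : Ck_on k.+1 A f -> Ck_on k A f.
Proof.
elim: k f => [|k IH] f [df ckf] /=.
  by move=> x Ax; apply: differentiable_continuous; exact: df.
by split=> // v; exact/IH/ckf.
Qed.

Lemma Ck_cst V W k (A : set V) (c : W) : Ck_on k A (cst c : V -> W).
Proof.
elim: k c => [|k IH] c /=; first by move=> x _; exact: cst_continuous.
split=> [x _|v]; first exact: differentiable_cst.
by have -> : 'D_v (cst c : V -> W) = cst 0 by apply/funext => x; rewrite derive_cst.
Qed.

Lemma Ck_linear V W k (A : set V) (f : {linear V -> W}) :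
  continuous f -> Ck_on k A f.
Proof.
case: k => [|k] cf /=; first by move=> x _; exact: cf.
split=> [x _|v]; first exact: linear_differentiable.
suff -> : 'D_v f = cst (f v) by exact: Ck_cst.
apply/funext => x; rewrite deriveE ?diff_lin //; exact: linear_differentiable.
Qed.

Lemma Ck_add V W k (A : set V) (f g : V -> W) : open A ->
  Ck_on k A f -> Ck_on k A g -> Ck_on k A (fun x => f x + g x).
Proof.
move=> oA; elim: k f g => [|k IH] f g /=.
  by move=> cf cg x Ax; apply: continuousD; [exact: cf|exact: cg].
move=> [df cf] [dg cg]; split=> [x Ax|v].
  by apply: differentiableD; [exact: df|exact: dg].
apply: Ck_eq (IH _ _ (cf v) (cg v)) => // x Ax.
by rewrite deriveD //; apply: diff_derivable; [exact: df|exact: dg].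
Qed.

Lemma Ck_scale V W k (A : set V) (f : V -> R) (c : W) : open A ->
  Ck_on k A f -> Ck_on k A (fun x => f x *: c).
Proof.
move=> oA; elim: k f => [|k IH] f /=.
  by move=> cf x Ax; apply: cvgZr_tmp; exact: cf.
move=> [df cf]; split=> [x Ax|v]; first exact/differentiableZl/df.
apply: Ck_eq (IH _ (cf v)) => // x Ax.
have dfc : differentiable (fun x => f x *: c) x.
  exact: differentiableZl (df x Ax).
rewrite [RHS]deriveE // (diffZl c (df x Ax)).
by rewrite deriveE //; exact: df.
Qed.

Lemma Ck_mul V k (A : set V) (f g : V -> R) : open A ->
  Ck_on k A f -> Ck_on k A g -> Ck_on k A (fun x => f x * g x).
Proof.
move=> oA; elim: k f g => [|k IH] f g.
  by move=> cf cg x Ax; apply: continuousM; [exact: cf|exact: cg].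
move=> cf0 cg0; have cf' := Ck_pred cf0; have cg' := Ck_pred cg0.
case: cf0 cg0 => df cf [dg cg]; split=> [x Ax|v].
  by apply: differentiableM; [exact: df|exact: dg].
apply: Ck_eq (Ck_add oA (IH _ _ cf' (cg v)) (IH _ _ cg' (cf v))) => // x Ax.
by rewrite deriveM //; apply: diff_derivable; [exact: df|exact: dg].
Qed.

(** The chain rule expresses the derivative of g o f through g' o f, which is
    why the induction on k must keep g arbitrary. *)
Lemma Ck_comp V k (A : set V) (B : set R) (g : R -> R) (f : V -> R) :
  open A -> (forall x, A x -> B (f x)) ->
  Ck_on k B g -> Ck_on k A f -> Ck_on k A (fun x => g (f x)).
Proof.
move=> oA AB; elim: k g => [|k IH] g.
  move=> cg cf x Ax; apply: continuous_comp; first exact: cf.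
  by apply: cg; exact: AB.
move=> [dg cg] cf0; have cf' := Ck_pred cf0; case: cf0 => df cf.
split=> [x Ax|v].
  by apply: differentiable_comp; [exact: df|exact/dg/AB].
apply: Ck_eq (Ck_mul oA (cf v) (IH _ (cg 1) cf')) => // x Ax.
rewrite [in RHS]deriveE; last first.
  by apply: differentiable_comp; [exact: df|exact/dg/AB].
rewrite deriveE; last exact: df.
rewrite deriveE; last exact/dg/AB.
rewrite (diff_comp (df x Ax) (dg _ (AB x Ax))) /=.
by rewrite -{2}['d f x v]mulr1 -[_ * 1]/(_ *: 1) linearZ.
Qed.

(** For a function of one real variable one derivative decides, since the
    derivative along v is v times it. *)
Lemma Ck_real k (B : set R) (g g' : R -> R) : open B ->
  (forall x, B x -> is_derive x 1 g (g' x)) -> Ck_on k B g' -> Ck_on k.+1 B g.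
Proof.
move=> oB dg cg'; split=> [x Bx|v].
  by apply/derivable1_diffP; have [] := dg x Bx.
apply: Ck_eq (Ck_mul oB (Ck_cst k B v) cg') => // x Bx.
have [dgx <-] := dg x Bx; move/derivable1_diffP: dgx => dgx.
by rewrite !deriveE //= -{2}[v]mulr1 -[v * 1]/(v *: 1) linearZ.
Qed.

Lemma Ck_cos_sin k : Ck_on k setT (@cos R) /\ Ck_on k setT (@sin R).
Proof.
elim: k => [|k [ck sk]].
  by split=> x _; [exact: continuous_cos|exact: continuous_sin].
split; last by apply: (Ck_real openT _ ck) => x _; exact: is_derive_sin.
apply: (Ck_real openT (g' := fun x => -1 * sin x)) => [x _|].
  by rewrite mulN1r; exact: is_derive_cos.
by apply: Ck_mul (Ck_cst _ _ _) sk; exact: openT.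
Qed.

Lemma Ck_inv k : Ck_on k [set x : R | x != 0] (@GRing.inv R).
Proof.
have oB : open [set x : R | x != 0] by exact: open_neq.
elim: k => [|k IH]; first by move=> x; exact: inv_continuous.
apply: (Ck_real oB (g' := fun x => -1 * (x^-1 * x^-1))) => [x x0|].
  have dx : derivable id x 1 by exact: derivable_id.
  apply: DeriveDef; first exact: derivableV x0 dx.
  by rewrite (deriveV x0 dx) derive_id mulN1r -invfM -expr2 /GRing.scale /= mulr1.
by apply: Ck_mul => //; [exact: Ck_cst|exact: Ck_mul].
Qed.

(** The derivative of the root is a composite of the inverse with the root, so
    one order of smoothness of the root gives the next. *)
Lemma Ck_sqrt k : Ck_on k [set x : R | 0 < x] (@Num.sqrt R).
Proof.
have oB : open [set x : R | 0 < x] by exact: open_gt.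
elim: k => [|k IH]; first by move=> x _; exact: sqrt_continuous.
apply: (Ck_real oB (g' := fun x => (2 * Num.sqrt x)^-1)).
apply: Ck_comp (@Ck_inv k) _ => //; first move=> x x0.
  by rewrite /= mulf_neq0 // gt_eqF // sqrtr_gt0.
by apply: Ck_mul => //; exact: Ck_cst.
Qed.

End Ck.

Section CkRow.
Variable R : realType.
Implicit Types V W : normedModType R.

Lemma Ck_sum V W k (A : set V) (I : Type) (s : seq I) (f : I -> V -> W) :
  open A -> (forall i, Ck_on k A (f i)) -> Ck_on k A (fun x => \sum_(i <- s) f i x).
Proof.
move=> oA cf; elim: s => [|i s IH].
  by under eq_fun do rewrite big_nil; exact: Ck_cst.
by under eq_fun do rewrite big_cons; exact: Ck_add.
Qed.

Lemma Ck_row V n k (A : set V) (f : V -> 'rV[R]_n) :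
  open A -> (forall j, Ck_on k A (fun x => f x 0 j)) -> Ck_on k A f.
Proof.
move=> oA cf.
have -> : f = fun x => \sum_j f x 0 j *: delta_mx 0 j.
  by apply/funext => x; exact: row_sum_delta.
by apply: Ck_sum => // j; exact: Ck_scale.
Qed.

Lemma Ck_coord n k (A : set 'rV[R]_n) j :
  Ck_on k A (fun U : 'rV[R]_n => U 0 j).
Proof.
have @f : {linear 'rV[R]_n -> R}.
  by exists (fun N : 'M[R]_(_, _) => N 0 j); do 2![eexists]; do ?[constructor];
     rewrite ?mxE// => ? *; rewrite ?mxE//; move=> ?; rewrite !mxE.
rewrite (_ : (fun _ => _) = f) //; apply: Ck_linear; exact: coord_continuous.
Qed.

Lemma Ck_opp V k (A : set V) (f : V -> R) : open A ->
  Ck_on k A f -> Ck_on k A (fun x => - f x).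
Proof.
move=> oA cf; under eq_fun do rewrite -mulN1r.
by apply: Ck_mul => //; exact: Ck_cst.
Qed.

Lemma DF_entry n (F : 'rV[R]_n -> 'rV[R]_n) U i j : differentiable F U ->
  DF F U i j = 'D_(delta_mx 0 j) (fun X => F X 0 i) U.
Proof.
move=> dF; have dFU : derivable F U (delta_mx 0 j) by exact: diff_derivable.
rewrite /DF mxE; have := derive_mx dFU.
rewrite deriveEjacobian // -rowE => /matrixP/(_ 0 i).
by rewrite !mxE.
Qed.

Lemma is_derive_coord n (U v : 'rV[R]_n) j :
  is_derive U v (fun X : 'rV[R]_n => X 0 j) (v 0 j).
Proof.
have dc : derivable (fun X : 'rV[R]_n => X 0 j : R) U v.
  exact/diff_derivable/differentiable_coord.
apply: DeriveDef => //.
have := derive_mx (M := id) (@derivable_id _ _ U v).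
by rewrite derive_id => /matrixP/(_ 0 j); rewrite mxE.
Qed.

End CkRow.

(** * Block diagonal matrices of size four *)

Section Dim4.

Definition i0 : 'I_4 := @Ordinal 4 0 isT.
Definition i1 : 'I_4 := @Ordinal 4 1 isT.
Definition i2 : 'I_4 := @Ordinal 4 2 isT.
Definition i3 : 'I_4 := @Ordinal 4 3 isT.

(** Case analysis on an index that leaves the canonical names, on which entries
    of explicit matrices compute. *)
Lemma ord4_ind (P : 'I_4 -> Prop) : P i0 -> P i1 -> P i2 -> P i3 -> forall i, P i.
Proof.
move=> p0 p1 p2 p3 i.
have : i \in [:: i0; i1; i2; i3] by case: i => [[|[|[|[|]]]]].
by rewrite !inE => /or4P[] /eqP->.
Qed.

Lemma sum_ord4 (V : nmodType) (F : 'I_4 -> V) :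
  \sum_i F i = F i0 + F i1 + F i2 + F i3.
Proof.
rewrite !big_ord_recl big_ord0 addr0 !addrA.
by congr (F _ + F _ + F _ + F _); exact/val_inj.
Qed.

(** The diagonal blocks are (a, b; c, d) and (e, f; g, h). *)
Definition blk (K : nzRingType) (a b c d e f g h : K) : 'M[K]_4 :=
  \matrix_(i, j) nth 0 (nth [::] [:: [:: a; b; 0; 0]; [:: c; d; 0; 0];
                                    [:: 0; 0; e; f]; [:: 0; 0; g; h]] i) j.

Definition col4 (K : nzRingType) (x y z t : K) : 'cV[K]_4 :=
  \col_i [:: x; y; z; t]`_i.

Lemma scalar_blk (K : nzRingType) (a : K) : a%:M = blk a 0 0 a a 0 0 a.
Proof. by apply/matrixP; do 2 elim/ord4_ind; rewrite !mxE. Qed.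

Lemma add_blk (K : nzRingType) (a b c d e f g h a' b' c' d' e' f' g' h' : K) :
  blk a b c d e f g h + blk a' b' c' d' e' f' g' h' =
  blk (a + a') (b + b') (c + c') (d + d') (e + e') (f + f') (g + g') (h + h').
Proof. by apply/matrixP; do 2 elim/ord4_ind; rewrite !mxE //= addr0. Qed.

Lemma scale_blk (K : nzRingType) (k a b c d e f g h : K) :
  k *: blk a b c d e f g h =
  blk (k * a) (k * b) (k * c) (k * d) (k * e) (k * f) (k * g) (k * h).
Proof. by apply/matrixP; do 2 elim/ord4_ind; rewrite !mxE //= mulr0. Qed.

Lemma opp_blk (K : nzRingType) (a b c d e f g h : K) :
  - blk a b c d e f g h = blk (- a) (- b) (- c) (- d) (- e) (- f) (- g) (- h).
Proof. by apply/matrixP; do 2 elim/ord4_ind; rewrite !mxE //= oppr0. Qed.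

Lemma map_blk (K L : nzRingType) (f : {rmorphism K -> L}) (a b c d a' b' c' d' : K) :
  map_mx f (blk a b c d a' b' c' d') =
  blk (f a) (f b) (f c) (f d) (f a') (f b') (f c') (f d').
Proof. by apply/matrixP; do 2 elim/ord4_ind; rewrite !mxE //= rmorph0. Qed.

Lemma mul_blk (K : nzRingType) (a b c d e f g h a' b' c' d' e' f' g' h' : K) :
  blk a b c d e f g h *m blk a' b' c' d' e' f' g' h' =
  blk (a * a' + b * c') (a * b' + b * d') (c * a' + d * c') (c * b' + d * d')
      (e * e' + f * g') (e * f' + f * h') (g * e' + h * g') (g * f' + h * h').
Proof.
by apply/matrixP; do 2 elim/ord4_ind; rewrite !mxE sum_ord4 !mxE /=
  ?(mul0r, mulr0, add0r, addr0).
Qed.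

Lemma mul_blk_col (K : nzRingType) (a b c d e f g h x y z t : K) :
  blk a b c d e f g h *m col4 x y z t =
  col4 (a * x + b * y) (c * x + d * y) (e * z + f * t) (g * z + h * t).
Proof.
by apply/matrixP; elim/ord4_ind => j; rewrite !mxE sum_ord4 !mxE /=
  ?(mul0r, mulr0, add0r, addr0).
Qed.

Lemma det_blk (K : comNzRingType) (a b c d e f g h : K) :
  \det (blk a b c d e f g h) = (a * d - b * c) * (e * h - f * g).
Proof.
pose m2 (x y z t : K) : 'M[K]_2 :=
  \matrix_(i, j) nth 0 (nth [::] [:: [:: x; y]; [:: z; t]] i) j.
have -> : blk a b c d e f g h = block_mx (m2 a b c d) 0 0 (m2 e f g h) :> 'M_(2 + 2).
  apply/matrixP; do 2 elim/ord4_ind; rewrite !mxE;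
    do 2 (case: splitP => [[[|[|//]] ?]|[[|[|//]] ?]] //= _; rewrite ?mxE //=).
rewrite (@det_lblock K 2 2).
suff dm2 x y z t : \det (m2 x y z t) = x * t - y * z by rewrite !dm2.
rewrite (expand_det_row _ 0) !big_ord_recl big_ord0 /cofactor !det_mx11 !mxE /=.
by rewrite /bump /=; ring.
Qed.

Lemma char_poly_blk (K : comNzRingType) (a b c d e f g h : K) :
  char_poly (blk a b c d e f g h) =
  (('X - a%:P) * ('X - d%:P) - (b * c)%:P) * (('X - e%:P) * ('X - h%:P) - (f * g)%:P).
Proof.
rewrite /char_poly /char_poly_mx scalar_blk map_blk opp_blk add_blk.
by rewrite det_blk !rmorphM /=; ring.
Qed.

End Dim4.

(** * The system and its Jacobians *)

Section System.
Variable R : realType.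
Implicit Types (U : 'rV[R]_4) (N : R * R).

Definition exF1 U : 'rV[R]_4 :=
  \row_j [:: U 0 i0 ^+ 2 / 2; - U 0 i1; 3 * U 0 i2; - (3 * U 0 i3)]`_j.

Definition exF2 U : 'rV[R]_4 :=
  \row_j [:: U 0 i1; U 0 i0; 3 * U 0 i3; 3 * U 0 i2]`_j.

Definition exD : set 'rV[R]_4 := [set U | -1 < U 0 i0 < 1].

Lemma exD_open : open exD.
Proof.
have -> : exD = (fun U : 'rV[R]_4 => U 0 i0) @^-1` [set` `](-1), 1[%R].
  by apply/seteqP; split=> U; rewrite /exD /= in_itv.
apply: open_comp; last exact: interval_open.
by move=> U _; exact: coord_continuous.
Qed.

Lemma smooth_exF1 A : open A -> smooth_on A exF1.
Proof.
move=> oA k; apply: Ck_row => //.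
have cc j : Ck_on k A (fun U => U 0 j) by exact: Ck_coord.
elim/ord4_ind; under eq_fun do rewrite mxE /=.
- by under eq_fun do rewrite expr2; do !apply: Ck_mul => //; exact: Ck_cst.
- exact: Ck_opp.
- by apply: Ck_mul => //; exact: Ck_cst.
- by apply: Ck_opp => //; apply: Ck_mul => //; exact: Ck_cst.
Qed.

Lemma smooth_exF2 A : open A -> smooth_on A exF2.
Proof.
move=> oA k; apply: Ck_row => //.
have cc j : Ck_on k A (fun U => U 0 j) by exact: Ck_coord.
elim/ord4_ind; under eq_fun do rewrite mxE /=; do ?exact: cc.
- by apply: Ck_mul => //; exact: Ck_cst.
- by apply: Ck_mul => //; exact: Ck_cst.
Qed.

Lemma DF_flux N U : DF (flux exF1 exF2 N) U =
  blk (N.1 * U 0 i0) N.2 N.2 (- N.1) (3 * N.1) (3 * N.2) (3 * N.2) (- (3 * N.1)).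
Proof.
have d1 : differentiable exF1 U.
  by have [df _] := smooth_exF1 openT 1; exact: df.
have d2 : differentiable exF2 U.
  by have [df _] := smooth_exF2 openT 1; exact: df.
have dN : differentiable (flux exF1 exF2 N) U.
  by apply: differentiableD; exact: differentiableZ.
pose c j := fun X : 'rV[R]_4 => X 0 j.
have cD j v : derivable (c j) U v by case: (is_derive_coord U v j).
have cE j v : 'D_v (c j) U = v 0 j by case: (is_derive_coord U v j).
have comb (a b : R) (f g : 'rV[R]_4 -> R) v : derivable f U v -> derivable g U v ->
    'D_v (a *: f + b *: g) U = a * 'D_v f U + b * 'D_v g U.
  move=> fU gU; rewrite (deriveD (derivableZ (k := a) fU) (derivableZ (k := b) gU)).
  by rewrite (deriveZ a fU) (deriveZ b gU).
have comb_c (a b : R) i j v : 'D_v (a *: c i + b *: c j) U = a * v 0 i + b * v 0 j.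
  by rewrite (comb _ _ _ _ _ (cD i v) (cD j v)) !cE.
apply/matrixP => i j; rewrite DF_entry //.
have -> v : 'D_v (fun X => flux exF1 exF2 N X 0 i) U =
  [:: N.1 * U 0 i0 * v 0 i0 + N.2 * v 0 i1; N.2 * v 0 i0 - N.1 * v 0 i1;
      3 * N.1 * v 0 i2 + 3 * N.2 * v 0 i3; 3 * N.2 * v 0 i2 - 3 * N.1 * v 0 i3]`_i.
  move: i; elim/ord4_ind => /=.
  (* Each component of the flux is a combination of a coordinate, or of its
     square, and of another coordinate. *)
  - have -> : (fun X => flux exF1 exF2 N X 0 i0) = (N.1 / 2) *: (c i0 * c i0) + N.2 *: c i1.
      by apply/funext => X; rewrite /flux !mxE !fctE /= /GRing.scale /= expr2 mulrCA mulrC.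
    rewrite (comb _ _ _ _ _ (derivableM (cD i0 v) (cD i0 v)) (cD i1 v)).
    by rewrite (deriveM (cD i0 v) (cD i0 v)) !cE /GRing.scale /= /c; field.
  - have -> : (fun X => flux exF1 exF2 N X 0 i1) = - N.1 *: c i1 + N.2 *: c i0.
      by apply/funext => X; rewrite /flux !mxE !fctE /= /GRing.scale /= mulrN mulNr.
    by rewrite comb_c; ring.
  - have -> : (fun X => flux exF1 exF2 N X 0 i2) = (3 * N.1) *: c i2 + (3 * N.2) *: c i3.
      by apply/funext => X; rewrite /flux !mxE !fctE /= /GRing.scale /= /c; ring.
    by rewrite comb_c.
  - have -> : (fun X => flux exF1 exF2 N X 0 i3) = (- 3 * N.1) *: c i3 + (3 * N.2) *: c i2.
      by apply/funext => X; rewrite /flux !mxE !fctE /= /GRing.scale /= /c; ring.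
    by rewrite comb_c; ring.
by move: i j; do 2 elim/ord4_ind; rewrite !mxE /=; ring.
Qed.

Lemma DF_exF1 U : DF exF1 U = blk (U 0 i0) 0 0 (-1) 3 0 0 (-3).
Proof.
have -> : exF1 = flux exF1 exF2 (e1 R).
  by apply/funext => X; rewrite /flux /e1 /= scale1r scale0r addr0.
by rewrite DF_flux /= mul1r !mulr1 !mulr0.
Qed.

Lemma DF_exF2 (c : R) U : DF (fun X => c *: exF2 X) U = blk 0 c c 0 0 (3 * c) (3 * c) 0.
Proof.
have -> : (fun X => c *: exF2 X) = flux exF1 exF2 (0, c).
  by apply/funext => X; rewrite /flux /= scale0r add0r.
by rewrite DF_flux /= !(mul0r, mulr0, oppr0).
Qed.

End System.

Arguments exF1 {R} U.
Arguments exF2 {R} U.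
Arguments exD {R} U.

(** * Strict hyperbolicity *)

Lemma factor_quadratic (K : comNzRingType) (a d c p q : K) :
  p + q = a + d -> p * q = a * d - c ->
  ('X - a%:P) * ('X - d%:P) - c%:P = ('X - p%:P) * ('X - q%:P) :> {poly K}.
Proof.
move=> /(congr1 (@polyC K)) + /(congr1 (@polyC K)).
rewrite !raddfD /= !rmorphN /= !rmorphM /= => sum prod.
transitivity ('X ^+ 2 - (a%:P + d%:P) * 'X + (a%:P * d%:P - c%:P)); first by ring.
by rewrite -sum -prod; ring.
Qed.

Section Spectrum.
Variable R : realType.
Implicit Types (U : 'rV[R]_4) (N : R * R).

Definition gap (u x y : R) := Num.sqrt (((u + 1) / 2 * x) ^+ 2 + y ^+ 2).
(** The upper eigenvalue of the shock block in the direction (x, y); the lower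
    one has the opposite sign in front of the root. *)
Definition mode (u x y : R) := (u - 1) / 2 * x + gap u x y.

Definition spectrum (u x y : R) : seq R :=
  [:: - (3 * Num.sqrt (x ^+ 2 + y ^+ 2)); (u - 1) / 2 * x - gap u x y;
      mode u x y; 3 * Num.sqrt (x ^+ 2 + y ^+ 2)].

Lemma sumsq_gt0 (x y : R) : (x, y) != (0, 0) -> 0 < x ^+ 2 + y ^+ 2.
Proof.
move=> xy0; rewrite lt_neqAle addr_ge0 ?sqr_ge0 // andbT eq_sym.
by apply: contra xy0; rewrite paddr_eq0 ?sqr_ge0 // !sqrf_eq0 => /andP[/eqP-> /eqP->].
Qed.

Lemma gap_radicand_gt0 (u x y : R) : -1 < u -> (x, y) != (0, 0) ->
  0 < ((u + 1) / 2 * x) ^+ 2 + y ^+ 2.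
Proof.
move=> u1 xy0; apply: sumsq_gt0; apply: contra xy0 => /eqP[/eqP + ->].
by rewrite mulf_eq0 => /orP[/eqP|/eqP->//] h; lra.
Qed.

(** With m = |(x, y)|, both (u - 1)/2 x and the root are at most m in
    absolute value, so the shock block has its eigenvalues in [-2m, 2m], strictly
    between -3m and 3m. *)
Lemma spectrum_sorted (u x y : R) : -1 < u < 1 -> (x, y) != (0, 0) ->
  sorted <%R (spectrum u x y).
Proof.
move=> /andP[u1 u2] xy0; have r0 : 0 < gap u x y.
  by rewrite sqrtr_gt0 gap_radicand_gt0.
have := sumsq_gt0 xy0; set m2 := _ + _ => m2_gt0.
set m := Num.sqrt m2; have m0 : 0 < m by rewrite sqrtr_gt0.
have rm : gap u x y <= m.
  apply: ler_wsqrtr; rewrite lerD2r exprMn ler_piMl ?sqr_ge0 //.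
  by rewrite expr_le1 //; lra.
have xm : `|x| <= m by rewrite -sqrtr_sqr; apply: ler_wsqrtr; rewrite lerDl sqr_ge0.
have hm : `|(u - 1) / 2 * x| <= m.
  rewrite normrM; apply: le_trans xm; rewrite ler_piMl // ler_norml; apply/andP; lra.
move: hm; rewrite ler_norml => /andP[h1 h2].
by rewrite /spectrum /mode /= -/m2 -/m andbT; apply/and3P; split; lra.
Qed.

Lemma char_poly_spectrum (u x y : R) :
  char_poly (blk (x * u) y y (- x) (3 * x) (3 * y) (3 * y) (- (3 * x))) =
  \prod_(a <- spectrum u x y) ('X - a%:P).
Proof.
rewrite char_poly_blk !big_cons big_nil mulr1.
have r2 : gap u x y ^+ 2 = ((u + 1) / 2 * x) ^+ 2 + y ^+ 2.
  by rewrite sqr_sqrtr // addr_ge0 // sqr_ge0.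
have m2 : Num.sqrt (x ^+ 2 + y ^+ 2) ^+ 2 = x ^+ 2 + y ^+ 2.
  by rewrite sqr_sqrtr // addr_ge0 // sqr_ge0.
rewrite (@factor_quadratic _ _ _ _ ((u - 1) / 2 * x - gap u x y) (mode u x y)).
- rewrite (@factor_quadratic _ _ _ _ (- (3 * Num.sqrt (x ^+ 2 + y ^+ 2)))
            (3 * Num.sqrt (x ^+ 2 + y ^+ 2))).
  + by rewrite [RHS]mulrCA -!mulrA; congr (_ * _); rewrite mulrCA; congr (_ * _);
      rewrite mulrC.
  + by ring.
  + transitivity (- 9 * (x ^+ 2 + y ^+ 2)); last by ring.
    by rewrite -[in RHS]m2; ring.
- by rewrite /mode; field.
- transitivity (((u - 1) / 2 * x) ^+ 2 - gap u x y ^+ 2); first by rewrite /mode; ring.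
  by rewrite r2; field.
Qed.

Lemma spectrum_diagonalizable (u x y : R) : -1 < u < 1 -> (x, y) != (0, 0) ->
  diagonalizable (blk (x * u) y y (- x) (3 * x) (3 * y) (3 * y) (- (3 * x))).
Proof.
move=> u1 xy0; apply/diagonalizableP; exists (spectrum u x y).
  by apply: (sorted_uniq lt_trans ltxx); exact: spectrum_sorted.
by rewrite -char_poly_spectrum; exact: mxminpoly_dvd_char.
Qed.

Lemma ordered_spectrum (u x y : R) : -1 < u < 1 -> (x, y) != (0, 0) ->
  ordered_eigenvalues
    (blk (x * u) y y (- x) (3 * x) (3 * y) (3 * y) (- (3 * x))) (spectrum u x y).
Proof.
move=> u1 xy0; split; last exact: char_poly_spectrum.
exact: sub_sorted (@ltW _ _) _ (spectrum_sorted u1 xy0).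
Qed.

Lemma ordered_eigenvalues_uniq n (A : 'M[R]_n) s t :
  ordered_eigenvalues A s -> ordered_eigenvalues A t -> s = t.
Proof.
move=> [ss ps] [st pt]; apply: (sorted_eq le_trans le_anti) => //.
by apply: prod_XsubC_eq; rewrite -ps.
Qed.

Lemma multiplicities_uniq (s : seq R) : uniq s ->
  [seq count_mem a s | a <- undup s] = nseq (size s) 1%N.
Proof.
move=> us; rewrite undup_id // -(size_map (fun a => count_mem a s)).
apply/all_pred1P; rewrite all_map.
by apply/allP => a sa /=; rewrite count_uniq_mem // sa.
Qed.

Lemma symmetric_ex A : symmetric_system (@exF1 R) (@exF2 R) A.
Proof.
have s2 : exF2 = (fun X => 1 *: exF2 X) :> ('rV[R]_4 -> 'rV[R]_4).
  by apply/funext => X; rewrite scale1r.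
move=> U _; rewrite s2 DF_exF1 DF_exF2.
by split; apply/matrixP; do 2 elim/ord4_ind; rewrite !mxE.
Qed.

Lemma hyperbolic_ex : constant_multiplicity_hyperbolic (@exF1 R) (@exF2 R) (@exD R).
Proof.
exists (nseq 4 1%N) => U [x y] U1 xy0; rewrite DF_flux /=; split.
  exact: spectrum_diagonalizable.
exists (spectrum (U 0 i0) x y); first exact: ordered_spectrum.
rewrite multiplicities_uniq //.
by apply: (sorted_uniq lt_trans ltxx); exact: spectrum_sorted.
Qed.

(** The symbol in the direction N with parameter xi is the Jacobian in the
    direction N + xi N^perp. *)
Definition exLam U N (xi : R) : R := mode (U 0 i0) (N.1 - xi * N.2) (N.2 + xi * N.1).

Lemma symbol_ex U N xi : symbol exF1 exF2 U N xi =
  blk ((N.1 - xi * N.2) * U 0 i0) (N.2 + xi * N.1) (N.2 + xi * N.1) (- (N.1 - xi * N.2))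
   (3 * (N.1 - xi * N.2)) (3 * (N.2 + xi * N.1)) (3 * (N.2 + xi * N.1))
   (- (3 * (N.1 - xi * N.2))).
Proof.
by rewrite /symbol !DF_flux /perp /= scale_blk add_blk; congr blk; ring.
Qed.

Lemma rotated_neq0 (c s xi : R) : c ^+ 2 + s ^+ 2 = 1 -> (c - xi * s, s + xi * c) != (0, 0).
Proof.
move=> cs; apply/eqP => -[h1 h2].
have : (c - xi * s) ^+ 2 + (s + xi * c) ^+ 2 = (1 + xi ^+ 2) * (c ^+ 2 + s ^+ 2) by ring.
by rewrite h1 h2 cs mulr1 !expr0n /= => h; have := sqr_ge0 xi; lra.
Qed.

Lemma simple_mode_ex : simple_mode (@exF1 R) (@exF2 R) (@exD R) i2 exLam.
Proof.
split; last first.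
  move=> U N xi U1 N1; rewrite symbol_ex.
  have xy0 := rotated_neq0 xi N1.
  exists (spectrum (U 0 i0) (N.1 - xi * N.2) (N.2 + xi * N.1)).
    exact: ordered_spectrum.
  split=> //; rewrite count_uniq_mem ?inE ?eqxx ?orbT //.
  by apply: (sorted_uniq lt_trans ltxx); exact: spectrum_sorted.
move=> k; set A := [set x | _].
have oA : open A.
  rewrite /A -[X in open X]/((fun x : 'rV[R]_4 * R * R => x.1.1) @^-1` @exD R).
  apply: open_comp; last exact: exD_open.
  by move=> x _; apply: continuous_comp; exact: cvg_fst.
have cU : Ck_on k A (fun x : 'rV[R]_4 * R * R => x.1.1 0 i0).
  have @f : {linear ('rV[R]_4 * R * R)%type -> R}.
    by exists (fun x : 'rV[R]_4 * R * R => x.1.1 0 i0); do 2![eexists]; do ?[constructor];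
     rewrite ?mxE// => ? *; rewrite ?mxE//; move=> ?; rewrite !mxE.
  rewrite (_ : (fun _ => _) = f) //; apply: Ck_linear => x.
  apply: (@continuous_comp _ _ _ (fun x : 'rV[R]_4 * R * R => x.1.1) (fun U => U 0 i0)).
    by apply: continuous_comp; exact: cvg_fst.
  exact: coord_continuous.
have cth : Ck_on k A (fun x : 'rV[R]_4 * R * R => x.1.2).
  have @f : {linear ('rV[R]_4 * R * R)%type -> R}.
    by exists (fun x : 'rV[R]_4 * R * R => x.1.2); do 2![eexists]; do ?[constructor].
  rewrite (_ : (fun _ => _) = f) //; apply: Ck_linear => x.
  apply: (@continuous_comp _ _ _ (fun x : 'rV[R]_4 * R * R => x.1) snd).
    exact: cvg_fst.
  exact: cvg_snd.
have cxi : Ck_on k A (fun x : 'rV[R]_4 * R * R => x.2).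
  have @f : {linear ('rV[R]_4 * R * R)%type -> R}.
    by exists (fun x : 'rV[R]_4 * R * R => x.2); do 2![eexists]; do ?[constructor].
  rewrite (_ : (fun _ => _) = f) //; apply: Ck_linear => x; exact: cvg_snd.
have [kc ks] := Ck_cos_sin R k.
have cc : Ck_on k A (fun x : 'rV[R]_4 * R * R => cos x.1.2) by exact: Ck_comp kc cth.
have cs : Ck_on k A (fun x : 'rV[R]_4 * R * R => sin x.1.2) by exact: Ck_comp ks cth.
have cst_k c : Ck_on k A (fun x : 'rV[R]_4 * R * R => c : R) by exact: Ck_cst.
rewrite /exLam /mode /gap /=.
have cx : Ck_on k A (fun x : 'rV[R]_4 * R * R => cos x.1.2 - x.2 * sin x.1.2).
  by apply: Ck_add => //; apply: Ck_opp => //; exact: Ck_mul.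
have cy : Ck_on k A (fun x : 'rV[R]_4 * R * R => sin x.1.2 + x.2 * cos x.1.2).
  by apply: Ck_add => //; exact: Ck_mul.
apply: Ck_add => //.
  by apply: Ck_mul => //; apply: Ck_mul => //; exact: Ck_add.
apply: (Ck_comp oA _ (@Ck_sqrt R k)).
  move=> x /andP[Ax _] /=; apply: gap_radicand_gt0 Ax _.
  by apply: rotated_neq0; rewrite cos2Dsin2.
under eq_fun do rewrite !expr2.
by apply: Ck_add => //; do !apply: Ck_mul => //; exact: Ck_add.
Qed.

End Spectrum.

(** * Convexity of the mode and its shocks *)

Section Convexity.
Variable R : realType.
Implicit Types (U : 'rV[R]_4) (N : R * R).

Lemma exLam_e1 U : exD U -> exLam U (e1 R) 0 = U 0 i0.
Proof.
move=> /andP[u1 _]; rewrite /exLam /mode /gap /= !mul0r subr0 addr0 expr0n addr0 !mulr1.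
by rewrite sqrtr_sqr ger0_norm; [field|lra].
Qed.

Lemma derive_hyperbola (k x : R) : 0 < k ->
  is_derive x 1 (fun xi => Num.sqrt (k ^+ 2 + xi ^+ 2))
    (x * (Num.sqrt (k ^+ 2 + x ^+ 2))^-1).
Proof.
move=> k0; have r0 : 0 < k ^+ 2 + x ^+ 2.
  by rewrite ltr_wpDr ?sqr_ge0 // exprn_gt0.
have dg : is_derive x 1 (fun xi : R => k ^+ 2 + xi ^+ 2) (2 * x).
  rewrite (_ : (fun _ => _) = cst (k ^+ 2) + (@id R) ^+ 2); last first.
    by apply/funext => y; rewrite !fctE.
  have cx : derivable (cst (k ^+ 2)) x (1 : R) by exact: derivable_cst.
  have idx : derivable id x (1 : R) by exact: derivable_id.
  have sx : derivable ((@id R) ^+ 2) x 1 by exact: derivableX.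
  apply: DeriveDef; first exact: derivableD cx sx.
  rewrite (deriveD cx sx) derive_cst add0r (deriveX 2 idx) derive_id.
  by rewrite expr1 /GRing.scale /= mulr1 mulr_natl.
have df : is_derive (k ^+ 2 + x ^+ 2) 1 Num.sqrt (2 * Num.sqrt (k ^+ 2 + x ^+ 2))^-1.
  exact: is_derive1_sqrt.
have := is_derive1_comp (f := Num.sqrt) (g := fun xi : R => k ^+ 2 + xi ^+ 2) df dg.
move=> h; apply: (is_derive_eq h).
have s0 : Num.sqrt (k ^+ 2 + x ^+ 2) != 0 by rewrite gt_eqF // sqrtr_gt0.
by field.
Qed.

(** Genuine nonlinearity: the mode is the coordinate u, while the first column of
    DF_1 - u I vanishes, so every vector of its left image has a zero first
    entry. Convexity: along xi the mode is a branch of a hyperbola. *)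
Lemma Metivier_convex_ex : Metivier_convex exF1 exF2 exD (@exLam R).
Proof.
move=> U DU; split.
  move=> [w] /matrixP/(_ 0 i0).
  have -> : flux exF1 exF2 (e1 R) = exF1.
    by apply/funext => X; rewrite /flux /e1 /= scale1r scale0r addr0.
  rewrite exLam_e1 // DF_exF1 !mxE sum_ord4 !mxE /= !subr0 subrr !mulr0 !addr0.
  have -> : 'D_(delta_mx 0 i0) (fun V => exLam V (e1 R) 0) U =
            'D_(delta_mx 0 i0) (fun V : 'rV[R]_4 => V 0 i0) U.
    apply: near_eq_derive; have := open_nbhs_nbhs (conj (@exD_open R) DU).
    by apply: filterS => V; exact: exLam_e1.
  have dc := is_derive_coord U (delta_mx 0 i0) i0.
  by rewrite derive_val !mxE !eqxx => /eqP; rewrite oner_eq0.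
have /andP[u1 _] := DU; set k := (U 0 i0 + 1) / 2; have k0 : 0 < k by rewrite /k; lra.
pose h : R -> R := fun xi => Num.sqrt (k ^+ 2 + xi ^+ 2).
have -> : exLam U (e1 R) = (cst ((U 0 i0 - 1) / 2) + h).
  apply/funext => xi; rewrite !fctE /exLam /mode /gap /h /= -/k.
  by rewrite mulr0 subr0 add0r !mulr1.
have d1 : ((cst ((U 0 i0 - 1) / 2) + h)^`())%classic =
          fun x => x * (Num.sqrt (k ^+ 2 + x ^+ 2))^-1.
  apply/funext => x; rewrite derive1E; have dh := derive_hyperbola x k0.
  by rewrite derive_val add0r.
rewrite derive1nS derive1n1 d1 derive1E.
have dh := derive_hyperbola 0 k0.
have s0 : Num.sqrt (k ^+ 2 + 0 ^+ 2) = k.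
  by rewrite expr0n addr0 sqrtr_sqr gtr0_norm.
have hk : h 0 != 0 by rewrite /h s0 gt_eqF.
have dh0 : derivable h 0 1 by case: dh.
have -> : (fun x => x * (Num.sqrt (k ^+ 2 + x ^+ 2))^-1) =
   (@id R) * (fun x => (h x)^-1) by apply/funext => x; rewrite !fctE.
have id0 : derivable (@id R) 0 1 by exact: derivable_id.
have dhV : derivable (fun x => (h x)^-1) 0 1 by exact: derivableV hk dh0.
rewrite (deriveM id0 dhV).
by rewrite derive_id scale0r add0r /h s0 /GRing.scale /= mulr1 invr_gt0.
Qed.

(** On the states considered the third eigenvalue of DF_1 is u, so the Lax
    conditions fix the sign of u on each side. *)
Lemma laxian_shock_ex (Um Up : 'rV[R]_4) : laxian_shock exF1 exD i2 Um Up ->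
  [/\ 0 < Um 0 i0 < 1 & -1 < Up 0 i0 < 0].
Proof.
move=> [Dm [Dp [_ [_ [[sm osm [_ sm2]] [sp osp [sp2 _]]]]]]].
have ev U s : exD U -> ordered_eigenvalues (DF exF1 U) s -> s`_2 = U 0 i0.
  move=> DU; have e0 : (1, 0) != (0, 0) :> R * R by apply/eqP => -[/eqP]; rewrite oner_eq0.
  have o1 : ordered_eigenvalues (DF exF1 U) (spectrum (U 0 i0) 1 0).
    by rewrite DF_exF1; move: (ordered_spectrum DU e0); rewrite mul1r mulr1 mulr0.
  move=> /(ordered_eigenvalues_uniq o1) <-; rewrite -[RHS](exLam_e1 DU).
  by rewrite /exLam /= !mul0r subr0 addr0.
rewrite -(ev Um sm) // -(ev Up sp) // sm2 sp2 !(ev _ _ Dm osm, ev _ _ Dp osp).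
by case/andP: Dm => _ ->; case/andP: Dp => ->.
Qed.

End Convexity.

(** * A continuous square root in the normal mode equation *)

Section ComplexTopology.
Variable R : realType.
Local Notation C := (R[i]^o).
Implicit Types z w : R[i].

(** A real-valued square of the modulus, for estimates: the norm of the field of
    complex numbers takes complex values. *)
Definition normsq z : R := complex.Re z ^+ 2 + complex.Im z ^+ 2.

Lemma normsq_ge0 z : 0 <= normsq z.
Proof. by rewrite addr_ge0 ?sqr_ge0. Qed.

Lemma normsqM z w : normsq (z * w) = normsq z * normsq w.
Proof. by case: z w => a b [c d]; rewrite /normsq /=; ring. Qed.

Lemma cvg_normsqP (T : Type) (F : set_system T) (FF : Filter F) (f : T -> C) (l : C) :
  f @ F --> l <-> (forall e : R, 0 < e -> \forall x \near F, normsq (l - f x) < e).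
Proof.
split=> [fl e e0|h].
  have e0' : 0 < (Num.sqrt e)%:C%C :> R[i] by rewrite ltcR sqrtr_gt0.
  move/cvgrPdist_lt: fl => /(_ _ e0'); apply: filterS => x.
  by rewrite normc_def ltcR ltr_sqrt.
apply/cvgrPdist_lt => -[e e'] /=; rewrite ltcE /= => /andP[/eqP-> e0].
have := h _ (exprn_gt0 2 e0); apply: filterS => x lt_e.
by rewrite normc_def ltcE /= eqxx -(gtr0_norm e0) -sqrtr_sqr ltr_sqrt // exprn_gt0.
Qed.

Lemma continuous_real_complex : continuous (fun x : R => x%:C%C : C).
Proof.
move=> x; apply/cvg_normsqP => e e0.
have e0' : 0 < Num.sqrt e by rewrite sqrtr_gt0.
near=> y; rewrite /normsq /= subrr expr0n addr0.
rewrite -ltr_sqrt // sqrtr_sqr.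
by near: y; move: (@cvg_id _ (nbhs x)) => /cvgrPdist_lt; apply.
Unshelve. all: by end_near. Qed.

(** The principal root, which is the branch needed where Re w >= 0. Folding the
    left half-plane onto the right one makes it continuous everywhere, so that
    no domain has to be carried along. *)
Definition half_sqrt w : R[i] := sqrtc (Complex `|complex.Re w| (complex.Im w)).

Lemma half_sqrtK w : 0 <= complex.Re w -> half_sqrt w ^+ 2 = w.
Proof. by move=> w0; rewrite /half_sqrt sqr_sqrtc ger0_norm //; case: w w0. Qed.

Lemma half_sqrt_cone w : `|complex.Im (half_sqrt w)| <= complex.Re (half_sqrt w).
Proof.
rewrite /half_sqrt /=; set a := complex.Re w; set b := complex.Im w.
rewrite real_normK ?num_real //; set r := Num.sqrt (a ^+ 2 + b ^+ 2).
have := sqrtr_ge0 (a ^+ 2 + b ^+ 2); rewrite -/r => r0.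
rewrite normrM (ger0_norm (sqrtr_ge0 _)).
apply: (@le_trans _ _ (Num.sqrt ((r - `|a|) / 2))).
  by rewrite ler_piMl ?sqrtr_ge0 //; case: eqP => _; rewrite ?normr1 // normr_sg; case: eqP.
by apply: ler_wsqrtr; have := normr_ge0 a; lra.
Qed.

(** Both roots s and t lie in the cone |Im| <= Re, so their scalar product is
    nonnegative and |s - t| <= |s + t|; hence |s - t|^2 <= |s^2 - t^2|. *)
Lemma half_sqrt_holder w w' :
  normsq (half_sqrt w - half_sqrt w') ^+ 2 <= normsq (w - w').
Proof.
have := half_sqrt_cone w; have := half_sqrt_cone w'.
have e1 : half_sqrt w ^+ 2 = Complex `|complex.Re w| (complex.Im w) := sqr_sqrtc _.
have e2 : half_sqrt w' ^+ 2 = Complex `|complex.Re w'| (complex.Im w') := sqr_sqrtc _.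
set s := half_sqrt w in e1 *; set t := half_sqrt w' in e2 *; rewrite !ler_norml.
move=> /andP[t1 t2] /andP[s1 s2].
have st : normsq (s - t) <= normsq (s + t).
  rewrite -subr_ge0 (_ : _ - _ =
    4 * (complex.Re s * complex.Re t + complex.Im s * complex.Im t)).
    nra.
  by move: s t {e1 e2 t1 t2 s1 s2} => [a b] [c d]; rewrite /normsq /=; ring.
apply: (@le_trans _ _ (normsq (s - t) * normsq (s + t))).
  by rewrite expr2 ler_wpM2l // normsq_ge0.
rewrite -normsqM -subr_sqr e1 e2 /normsq /=.
case: w w' {e1 e2 s t t1 t2 s1 s2 st} => a b [c d] /=; rewrite lerD2r.
rewrite -[leRHS]real_normK ?num_real // -[leLHS]real_normK ?num_real //.
by rewrite ler_sqr ?nnegrE ?normr_ge0 // ler_dist_dist.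
Qed.

Lemma half_sqrt_continuous : continuous (half_sqrt : C -> C).
Proof.
move=> w.
apply/(@cvg_normsqP C (nbhs w) (nbhs_filter w) half_sqrt (half_sqrt w)) => e e0.
have := (@cvg_normsqP C (nbhs w) (nbhs_filter w) id w).1 (@cvg_id _ _) _ (exprn_gt0 2 e0).
apply: filterS => x; move=> /(le_lt_trans (half_sqrt_holder w x)).
by rewrite ltr_sqr ?nnegrE ?normsq_ge0 // ltW.
Qed.

Implicit Types zeta : C * R.

(** A root of a^2 tau^2 + b^2 xi^2 with nonnegative real part. The principal
    root of the sum is discontinuous on the imaginary axis, but each factor
    of (a tau + i b xi)(a tau - i b xi) stays in the closed right half-plane. *)
Definition omega (a b : R) zeta : C :=
  half_sqrt (a%:C%C * zeta.1 + Complex 0 (b * zeta.2)) *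
  half_sqrt (a%:C%C * zeta.1 - Complex 0 (b * zeta.2)).

Lemma continuous_tau : continuous (fun zeta => zeta.1).
Proof. by move=> x; exact: cvg_fst. Qed.

Lemma continuous_i_xi (b : R) : continuous (fun zeta => Complex 0 (b * zeta.2) : C).
Proof.
have -> : (fun zeta => Complex 0 (b * zeta.2) : C) =
          (fun zeta => (Complex 0 b : C) * ((zeta.2)%:C%C : C)).
  by apply/funext => zeta; simpc.
move=> x; apply: cvgM; first exact: cvg_cst.
apply: (@continuous_comp _ _ _ snd (fun x : R => x%:C%C : C)); first exact: cvg_snd.
exact: continuous_real_complex.
Qed.

(** The sum and product rules with the codomain made explicit: complex-valued
    expressions are formed in the ring R[i], and only R[i]^o has a topology. *)
Lemma cvg_addC (T : Type) (F : set_system T) (FF : Filter F) (f g : T -> C) (a b : C) :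
  f x @[x --> F] --> a -> g x @[x --> F] --> b -> (f x + g x) @[x --> F] --> a + b.
Proof. by move=> fa gb; exact: (cvgD fa gb). Qed.

Lemma cvg_mulC (T : Type) (F : set_system T) (FF : Filter F) (f g : T -> C) (a b : C) :
  f x @[x --> F] --> a -> g x @[x --> F] --> b -> (f x * g x) @[x --> F] --> a * b.
Proof. by move=> fa gb; exact: (cvgM fa gb). Qed.

Lemma continuous_addC (T : topologicalType) (f g : T -> C) :
  continuous f -> continuous g -> continuous (fun x => f x + g x).
Proof. by move=> cf cg x; exact: cvgD (cf x) (cg x). Qed.

Lemma continuous_oppC (T : topologicalType) (f : T -> C) :
  continuous f -> continuous (fun x => - f x).
Proof. by move=> cf x; exact: cvgN (cf x). Qed.

Lemma continuous_mulC (T : topologicalType) (f g : T -> C) :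
  continuous f -> continuous g -> continuous (fun x => f x * g x).
Proof. by move=> cf cg x; exact: cvgM (cf x) (cg x). Qed.

Lemma omega_continuous a b : continuous (omega a b).
Proof.
have cr : continuous (fun zeta => a%:C%C * zeta.1 : C).
  by move=> x; apply: cvgM; [exact: cvg_cst|exact: continuous_tau].
have hs (f : C * R -> C) : continuous f -> continuous (fun zeta => half_sqrt (f zeta) : C).
  move=> cf z; apply: (@continuous_comp _ _ _ f (half_sqrt : C -> C)); first exact: cf.
  exact: half_sqrt_continuous.
have ci := @continuous_i_xi b.
apply: continuous_mulC.
  exact: hs (continuous_addC cr ci).
exact: hs (continuous_addC cr (continuous_oppC ci)).
Qed.

Lemma omega_sqr a b zeta : 0 <= a -> 0 <= complex.Re zeta.1 ->
  omega a b zeta ^+ 2 = (a%:C%C * zeta.1) ^+ 2 + ((b * zeta.2)%:C%C) ^+ 2.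
Proof.
move: zeta => [[x y] xi] /= a0 x0; rewrite /omega /= exprMn !half_sqrtK /=.
- by rewrite !expr2; simpc; congr Complex; ring.
- by simpc; rewrite mulr_ge0.
- by simpc; rewrite mulr_ge0.
Qed.

Lemma omega_Re_ge0 a b zeta : 0 <= complex.Re (omega a b zeta).
Proof.
rewrite /omega; set w := _ + _; set w' := _ - _.
have := half_sqrt_cone w; have := half_sqrt_cone w'.
case: (half_sqrt w) (half_sqrt w') => p q [p' q'] /=; rewrite !ler_norml.
by move=> /andP[h1 h2] /andP[h3 h4]; nra.
Qed.

(** If p + iq = omega, X + iY = a tau and B = b xi, then comparing real and
    imaginary parts of the squares gives (p^2 - X^2)(p^2 + Y^2) = p^2 B^2. So
    p >= X, unless p = Y = 0, and then X = 0 because -q^2 = X^2 + B^2. *)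
Lemma omega_Re_ge a b zeta : 0 <= a -> 0 <= complex.Re zeta.1 ->
  a * complex.Re zeta.1 <= complex.Re (omega a b zeta).
Proof.
move=> a0 x0; have := omega_sqr b a0 x0; have := omega_Re_ge0 a b zeta.
case: (omega a b zeta) => p q /= p0; move: x0; case: zeta => [[x y] xi] /= x0.
rewrite !expr2; simpc => -[e1 e2].
have X0 := mulr_ge0 a0 x0; rewrite leNgt; apply/negP => pX.
have {e1} : p ^+ 2 - q ^+ 2 = (a * x) ^+ 2 - (a * y) ^+ 2 + (b * xi) ^+ 2.
  by rewrite !expr2; lra.
have {e2} : p * q = (a * x) * (a * y) by lra.
move: X0 pX; move: (a * x) (a * y) (b * xi) => X Y B X0 pX pq pmq.
have h1 : (p ^+ 2 - X ^+ 2) * (p ^+ 2 + Y ^+ 2) = p ^+ 2 * B ^+ 2.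
  transitivity (p ^+ 2 * (p ^+ 2 - q ^+ 2 - X ^+ 2 + Y ^+ 2) + (p * q) ^+ 2 - (X * Y) ^+ 2).
    by ring.
  by rewrite pmq pq; ring.
have h2 : p ^+ 2 < X ^+ 2 by rewrite ltr_sqr ?nnegrE.
have h3 : p ^+ 2 + Y ^+ 2 = 0.
  by have := sqr_ge0 p; have := sqr_ge0 Y; have := sqr_ge0 B; nra.
by have := sqr_ge0 p; have := sqr_ge0 Y; have := sqr_ge0 B; have := sqr_ge0 q; nra.
Qed.

End ComplexTopology.

(** * Stable and unstable spaces of a matrix *)

Lemma char_poly_tr (K : comNzRingType) n (A : 'M[K]_n) : char_poly A^T = char_poly A.
Proof.
rewrite /char_poly -[RHS]det_tr /char_poly_mx; congr (\det _).
by rewrite linearB /= tr_scalar_mx map_trmx.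
Qed.

Section SpectralSpaces.
Variables (R : realType) (n : nat).
Local Notation C := (R[i]^o).
Implicit Types (A B Q : 'M[C]_n.+1) (v x : 'cV[C]_n.+1) (W : {vspace 'cV[C]_n.+1}).

Lemma generalized_eigenspaceP A a x :
  reflect ((A - a%:M) ^+ n.+1 *m x = 0) (x \in generalized_eigenspace A a).
Proof. by rewrite memv_ker lfunE; exact: eqP. Qed.

Lemma complex_eigenvalues_eigenvector A v mu :
  v != 0 -> A *m v = mu *: v -> mu \in complex_eigenvalues A.
Proof.
move=> v0 Av; rewrite /complex_eigenvalues.
case: closed_field_poly_normal => s /=.
rewrite (monicP (char_poly_monic A)) scale1r => cA.
rewrite -root_prod_XsubC -cA -(char_poly_tr A) -eigenvalue_root_char.
apply/eigenvalueP; exists v^T; last by rewrite trmx_eq0.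
by rewrite -trmx_mul Av linearZ.
Qed.

Lemma eigenvector_generalized A v mu :
  A *m v = mu *: v -> v \in generalized_eigenspace A mu.
Proof.
move=> Av; apply/generalized_eigenspaceP; rewrite exprSr -mulmxE -mulmxA.
by rewrite mulmxBl Av mul_scalar_mx subrr mulmx0.
Qed.

Lemma eigenvector_stable A v mu : v != 0 -> A *m v = mu *: v ->
  complex.Re mu < 0 -> v \in stable_space A.
Proof.
move=> v0 Av mu0; rewrite /stable_space.
rewrite (big_rem mu) ?(complex_eigenvalues_eigenvector v0 Av) //= mu0.
by apply: (subvP (addvSl _ _)); exact: eigenvector_generalized.
Qed.

Lemma eigenvector_unstable A v mu : v != 0 -> A *m v = mu *: v ->
  0 < complex.Re mu -> v \in unstable_space A.
Proof.
move=> v0 Av mu0; rewrite /unstable_space.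
rewrite (big_rem mu) ?(complex_eigenvalues_eigenvector v0 Av) //= mu0.
by apply: (subvP (addvSl _ _)); exact: eigenvector_generalized.
Qed.

Lemma stable_space_sub A W :
  (forall a x, complex.Re a < 0 -> x \in generalized_eigenspace A a -> x \in W) ->
  (stable_space A <= W)%VS.
Proof.
move=> h; rewrite /stable_space; elim/big_rec : _ => [|a V a0 VW]; first exact: sub0v.
by rewrite subv_add VW andbT; apply/subvP => x; exact: h.
Qed.

Lemma unstable_space_sub A W :
  (forall a x, 0 < complex.Re a -> x \in generalized_eigenspace A a -> x \in W) ->
  (unstable_space A <= W)%VS.
Proof.
move=> h; rewrite /unstable_space; elim/big_rec : _ => [|a V a0 VW]; first exact: sub0v.
by rewrite subv_add VW andbT; apply/subvP => x; exact: h.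
Qed.

(** The intertwining carries over to powers of A - a and B - a, and the latter are
    invertible. This shows that Q annihilates all the generalized eigenspaces for
    numbers outside the spectrum of B; with Q of rank one it says that a left
    eigenvector annihilates the generalized eigenspaces of other eigenvalues. *)
Lemma intertwined_kernel A B Q a x : Q *m A = B *m Q -> \det (B - a%:M) != 0 ->
  x \in generalized_eigenspace A a -> Q *m x = 0.
Proof.
move=> QA dB /generalized_eigenspaceP Ax.
have QAa k : Q *m (A - a%:M) ^+ k = (B - a%:M) ^+ k *m Q.
  elim: k => [|k IH]; first by rewrite !expr0 mulmx1 mul1mx.
  rewrite exprSr -mulmxE mulmxA IH exprSr -mulmxE -!mulmxA; congr (_ *m _).
  by rewrite mulmxBr mulmxBl QA scalar_mxC.
have BQx : (B - a%:M) ^+ n.+1 *m (Q *m x) = 0.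
  by rewrite mulmxA -QAa -mulmxA Ax mulmx0.
have uB : (B - a%:M) ^+ n.+1 \in unitmx.
  suff dX k : \det ((B - a%:M) ^+ k) != 0 by rewrite unitmxE unitfE.
  elim: k => [|k IH]; first by rewrite expr0 det1 oner_eq0.
  by rewrite exprS -mulmxE det_mulmx mulf_neq0.
by rewrite -[LHS](mulKmx uB) BQx mulmx0.
Qed.

End SpectralSpaces.

(** * The two blocks of the Lopatinski matrix *)

Section LopatinskiBlocks.
Variable R : realType.
Local Notation C := (R[i]^o).

(** Each block is (alpha t, -Y; beta Y, -gamma t), with Y = i xi, and s and d are
    the half sum and the half difference of alpha and gamma: the eigenvalues of
    the block are then d t + w and d t - w, where w^2 = s^2 t^2 - beta Y^2. *)
Definition lop_blk (s d b s' d' b' t Y : C) : 'M[C]_4 :=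
  blk ((s + d) * t) (- Y) (b * Y) (- ((s - d) * t))
      ((s' + d') * t) (- Y) (b' * Y) (- ((s' - d') * t)).

Lemma lopatinski_matrix_blk (U : 'rV[R]_4) (zeta : C * R) : U 0 i0 != 0 ->
  lopatinski_matrix exF1 exF2 U zeta =
  lop_blk ((((U 0 i0)^-1 + 1) / 2)%:C)%C ((((U 0 i0)^-1 - 1) / 2)%:C)%C ((U 0 i0)^-1%:C)%C
    ((3^-1)%:C)%C 0 1 zeta.1 (Complex 0 zeta.2).
Proof.
case: zeta => -[x y] xi u0; rewrite /lopatinski_matrix DF_exF2 DF_exF1 !map_blk.
rewrite scalar_blk scale_blk add_blk.
set A1 := blk _ _ _ _ _ _ _ _.
set A2 := blk ((U 0 i0)%:C)%C _ _ _ _ _ _ _.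
pose A3 : 'M[C]_4 := blk ((U 0 i0)^-1%:C)%C 0 0 (-1) ((3^-1)%:C)%C 0 0 (- (3^-1)%:C)%C.
have h1 : A2 *m A3 = 1%:M.
  rewrite /A2 /A3 mul_blk scalar_blk.
  by congr blk; apply/eqP; rewrite eq_complex /=; apply/andP; split; apply/eqP; field.
have -> : invmx A2 = A3.
  by rewrite -[RHS](mulKmx (mulmx1_unit h1).1) h1 mulmx1.
rewrite /A1 /A3 mul_blk /lop_blk.
by congr blk; apply/eqP; rewrite eq_complex /=; apply/andP; split; apply/eqP; field.
Qed.

Lemma scale_col4 (k x y z u : C) :
  k *: col4 x y z u = col4 (k * x) (k * y) (k * z) (k * u).
Proof. by apply/matrixP; elim/ord4_ind => j; rewrite !mxE. Qed.

Lemma add_col4 (x y z u x' y' z' u' : C) :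
  col4 x y z u + col4 x' y' z' u' = col4 (x + x') (y + y') (z + z') (u + u').
Proof. by apply/matrixP; elim/ord4_ind => j; rewrite !mxE. Qed.

Lemma col4_eta (v : 'cV[C]_4) : v = col4 (v i0 0) (v i1 0) (v i2 0) (v i3 0).
Proof. by apply/matrixP; elim/ord4_ind => j; rewrite !mxE ord1. Qed.

Lemma col4_eq0 (x y z u : C) :
  (col4 x y z u == 0) = [&& x == 0, y == 0, z == 0 & u == 0].
Proof.
apply/eqP/and4P => [/matrixP h|[/eqP-> /eqP-> /eqP-> /eqP->]].
  by have := (h i0 0, h i1 0, h i2 0, h i3 0); rewrite !mxE /= => -[[[-> ->] ->] ->].
by apply/matrixP; elim/ord4_ind => j; rewrite !mxE.
Qed.

(** In a block with f = s t + w, the vectors (Y, f) and (f, b Y) are eigenvectors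
    for d t - w and d t + w, and their annihilators (f, -Y) and (b Y, -f) are left
    eigenvectors for d t + w and d t - w. All four stay nonzero at xi = 0 as long
    as f does. *)

Section Block.
Variables (s d b s' d' b' t Y w w' : C).
Hypothesis w2 : w ^+ 2 = (s * t) ^+ 2 - b * Y ^+ 2.
Hypothesis w2' : w' ^+ 2 = (s' * t) ^+ 2 - b' * Y ^+ 2.

Let M : 'M[C]_4 := lop_blk s d b s' d' b' t Y.
Let f := s * t + w.
Let f' := s' * t + w'.

Let sub1 (x y k : C) : x - y = k * (w ^+ 2 - ((s * t) ^+ 2 - b * Y ^+ 2)) -> x = y.
Proof. by rewrite w2 subrr mulr0 => /eqP; rewrite subr_eq0 => /eqP. Qed.

Let sub2 (x y k : C) : x - y = k * (w' ^+ 2 - ((s' * t) ^+ 2 - b' * Y ^+ 2)) -> x = y.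
Proof. by rewrite w2' subrr mulr0 => /eqP; rewrite subr_eq0 => /eqP. Qed.

Lemma lop_stable1 : M *m col4 Y f 0 0 = (d * t - w) *: col4 Y f 0 0.
Proof.
rewrite /M /lop_blk mul_blk_col scale_col4 /f; congr col4; try by ring.
by apply: (sub1 (k := 1)); ring.
Qed.

Lemma lop_stable2 : M *m col4 0 0 Y f' = (d' * t - w') *: col4 0 0 Y f'.
Proof.
rewrite /M /lop_blk mul_blk_col scale_col4 /f'; congr col4; try by ring.
by apply: (sub2 (k := 1)); ring.
Qed.

Lemma lop_unstable2 : M *m col4 0 0 f' (b' * Y) = (d' * t + w') *: col4 0 0 f' (b' * Y).
Proof.
rewrite /M /lop_blk mul_blk_col scale_col4 /f'; congr col4; try by ring.
by apply: (sub2 (k := -1)); ring.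
Qed.

Lemma lop_left_unstable1 :
  blk f (- Y) 0 0 0 0 0 0 *m M = (d * t + w)%:M *m blk f (- Y) 0 0 0 0 0 0.
Proof.
rewrite /M /lop_blk scalar_blk !mul_blk /f; congr blk; try by ring.
by apply: (sub1 (k := -1)); ring.
Qed.

Lemma lop_left_unstable2 :
  blk 0 0 0 0 f' (- Y) 0 0 *m M = (d' * t + w')%:M *m blk 0 0 0 0 f' (- Y) 0 0.
Proof.
rewrite /M /lop_blk scalar_blk !mul_blk /f'; congr blk; try by ring.
by apply: (sub2 (k := -1)); ring.
Qed.

Lemma lop_left_stable2 :
  blk 0 0 0 0 (b' * Y) (- f') 0 0 *m M =
  (d' * t - w')%:M *m blk 0 0 0 0 (b' * Y) (- f') 0 0.
Proof.
rewrite /M /lop_blk scalar_blk !mul_blk /f'; congr blk; try by ring.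
by apply: (sub2 (k := -1)); ring.
Qed.

Lemma lop_left_block1 :
  blk 1 0 0 1 0 0 0 0 *m M =
  blk ((s + d) * t) (- Y) (b * Y) (- ((s - d) * t)) 0 0 0 0 *m blk 1 0 0 1 0 0 0 0.
Proof. by rewrite /M /lop_blk !mul_blk; congr blk; ring. Qed.

Let scalar_det (mu a : C) : mu != a -> \det ((mu%:M : 'M[C]_4) - a%:M) != 0.
Proof. by move=> mua; rewrite -raddfB det_scalar expf_neq0 // subr_eq0. Qed.

Hypothesis f_neq0 : f != 0.
Hypothesis f'_neq0 : f' != 0.
Hypothesis unstable2 : 0 < complex.Re (d' * t + w').
Hypothesis stable2 : complex.Re (d' * t - w') < 0.

(** The left eigenvectors for eigenvalues with positive real part annihilate the
    stable space; the vectors annihilated by (f, -Y) in each block are the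
    multiples of (Y, f). *)
Lemma lop_stable_space : 0 < complex.Re (d * t + w) -> complex.Re (d * t - w) < 0 ->
  stable_space M = <<[:: col4 Y f 0 0; col4 0 0 Y f']>>%VS.
Proof.
move=> unstable1 stable1; apply/eqP; rewrite eqEsubv; apply/andP; split; last first.
  apply/span_subvP => v; rewrite !inE => /orP[]/eqP->.
    apply: eigenvector_stable lop_stable1 stable1.
    by rewrite col4_eq0 (negPf f_neq0) !andbF.
  apply: eigenvector_stable lop_stable2 stable2.
  by rewrite col4_eq0 (negPf f'_neq0) !andbF.
apply: stable_space_sub => a x a0 xa.
have neq mu : 0 < complex.Re mu -> mu != a.
  by move=> mu0; apply: contraTneq mu0 => ->; rewrite -leNgt ltW.
have h1 := intertwined_kernel lop_left_unstable1 (scalar_det (neq _ unstable1)) xa.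
have h2 := intertwined_kernel lop_left_unstable2 (scalar_det (neq _ unstable2)) xa.
move: h1 h2; rewrite [x]col4_eta !mul_blk_col.
move=> /eqP; rewrite col4_eq0 => /and4P[/eqP h1 _ _ _].
move=> /eqP; rewrite col4_eq0 => /and4P[_ _ /eqP h2 _].
rewrite span_cons span_seq1; apply/memv_addP.
exists (x i1 0 / f *: col4 Y f 0 0); first by rewrite memvZ // memv_line.
exists (x i3 0 / f' *: col4 0 0 Y f'); first by rewrite memvZ // memv_line.
rewrite !scale_col4 add_col4 !mulr0 !addr0 !add0r !divfK //; congr col4.
  by apply: (mulfI f_neq0); move/eqP: h1; rewrite mulNr subr_eq0 => /eqP->; field.
by apply: (mulfI f'_neq0); move/eqP: h2; rewrite mulNr subr_eq0 => /eqP->; field.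
Qed.

(** The hypothesis says that the first block has no eigenvalue with positive real
    part; the projection onto that block then annihilates the unstable space. *)
Lemma lop_unstable_space :
  (forall a, 0 < complex.Re a ->
     (a - (s + d) * t) * (a + (s - d) * t) + b * Y ^+ 2 != 0) ->
  unstable_space M = <<[:: col4 0 0 f' (b' * Y)]>>%VS.
Proof.
move=> no_unstable1; apply/eqP; rewrite eqEsubv; apply/andP; split; last first.
  apply/span_subvP => v; rewrite !inE => /eqP->.
  apply: eigenvector_unstable lop_unstable2 unstable2.
  by rewrite col4_eq0 (negPf f'_neq0) !andbF.
apply: unstable_space_sub => a x a0 xa.
have neq mu : complex.Re mu < 0 -> mu != a.
  by move=> mu0; apply: contraTneq mu0 => ->; rewrite -leNgt ltW.
(* The second block of the intertwined matrix is 0, which suffices as a <> 0. *)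
have d1 : \det (blk ((s + d) * t) (- Y) (b * Y) (- ((s - d) * t)) 0 0 0 0 - a%:M) != 0.
  rewrite scalar_blk opp_blk add_blk det_blk mulf_neq0 //.
    by apply: contra (no_unstable1 a a0) => /eqP h; rewrite -[X in _ == X]h; apply/eqP; ring.
  have a_neq0 : a != 0 by apply: contraTneq a0 => ->; rewrite ltxx.
  by rewrite !oppr0 !add0r mulr0 subr0 mulrNN mulf_neq0.
have h1 := intertwined_kernel lop_left_block1 d1 xa.
have h2 := intertwined_kernel lop_left_stable2 (scalar_det (neq _ stable2)) xa.
move: h1 h2; rewrite [x]col4_eta !mul_blk_col.
move=> /eqP; rewrite col4_eq0 !mul1r !mul0r addr0 add0r => /and4P[/eqP -> /eqP -> _ _].
move=> /eqP; rewrite col4_eq0 => /and4P[_ _ /eqP h2 _].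
rewrite span_seq1; apply/vlineP; exists (x i2 0 / f').
rewrite scale_col4 !mulr0 divfK //; congr col4.
apply: (mulfI f'_neq0); move/eqP: h2; rewrite mulNr subr_eq0 => /eqP <-; field.
exact: f'_neq0.
Qed.

End Block.

End LopatinskiBlocks.

(** * Explicit normal modes *)

Section Frames.
Variable R : realType.
Local Notation C := (R[i]^o).
Implicit Types zeta : C * R.

Definition amp (s b : R) zeta : C := s%:C%C * zeta.1 + omega s b zeta.

(** Here k = 1/u, the inverse of the speed on the left of the shock. *)
Definition shock_stable (k : R) zeta : 'cV[C]_4 :=
  col4 (Complex 0 zeta.2 : C) (amp ((k + 1) / 2) (Num.sqrt k) zeta) 0 0.
Definition wave_stable zeta : 'cV[C]_4 := col4 0 0 (Complex 0 zeta.2 : C) (amp 3^-1 1 zeta).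
Definition wave_unstable zeta : 'cV[C]_4 := col4 0 0 (amp 3^-1 1 zeta) (Complex 0 zeta.2 : C).

Lemma amp_neq0 s b zeta : 0 < s -> 0 < complex.Re zeta.1 -> amp s b zeta != 0.
Proof.
move=> s0 x0; apply/eqP => /(congr1 (@complex.Re R)).
have := omega_Re_ge b (ltW s0) (ltW x0); have := mulr_gt0 s0 x0.
rewrite /amp; case: (omega s b zeta) => p q; case: zeta x0 => [[x y] xi] /= x0.
by move=> h1 h2 h3; lra.
Qed.

Lemma omega_sqr_sub s b zeta : 0 <= s -> 0 <= b -> 0 <= complex.Re zeta.1 ->
  omega s (Num.sqrt b) zeta ^+ 2 =
  (s%:C%C * zeta.1) ^+ 2 - b%:C%C * (Complex 0 zeta.2) ^+ 2.
Proof.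
move=> s0 b0 x0; rewrite omega_sqr //; congr (_ + _).
rewrite !expr2; simpc; apply/eqP; rewrite eq_complex /= ?oppr0 eqxx andbT.
by apply/eqP; rewrite -[in RHS](sqr_sqrtr b0); ring.
Qed.

Lemma omega3_sqr zeta : 0 <= complex.Re zeta.1 ->
  omega 3^-1 1 zeta ^+ 2 = ((3^-1)%:C%C * zeta.1) ^+ 2 - 1 * (Complex 0 zeta.2) ^+ 2.
Proof.
move=> x0; have := @omega_sqr_sub 3^-1 1 zeta; rewrite sqrtr1 => -> //.
by rewrite invr_ge0.
Qed.

Lemma Re_omega3 zeta : 0 < complex.Re zeta.1 -> 0 < complex.Re (omega 3^-1 1 zeta).
Proof.
move=> x0; have h3 : 0 < 3^-1 :> R by rewrite invr_gt0.
exact: lt_le_trans (mulr_gt0 h3 x0) (omega_Re_ge 1 (ltW h3) (ltW x0)).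
Qed.

(** For u > 0 the shock block has one eigenvalue on each side of the imaginary
    axis: by [omega_Re_ge], Re omega dominates s Re tau, which exceeds |d| Re tau. *)
Lemma stable_space_ex (U : 'rV[R]_4) zeta : 0 < U 0 i0 -> 0 < complex.Re zeta.1 ->
  stable_space (lopatinski_matrix exF1 exF2 U zeta) =
  <<[:: shock_stable ((U 0 i0)^-1)%R zeta; wave_stable zeta]>>%VS.
Proof.
move=> u0 x0; rewrite lopatinski_matrix_blk ?gt_eqF //.
have v0 : 0 < (U 0 i0)^-1 by rewrite invr_gt0.
move: (U 0 i0)^-1 v0 => v v0.
have s0 : 0 < (v + 1) / 2 by lra.
have w2 := omega_sqr_sub (ltW s0) (ltW v0) (ltW x0).
have w2' := omega3_sqr (ltW x0).
have := omega_Re_ge (Num.sqrt v) (ltW s0) (ltW x0); have := Re_omega3 x0.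
have := amp_neq0 (Num.sqrt v) s0 x0; have := @amp_neq0 3^-1 1 zeta _ x0.
rewrite /shock_stable /wave_stable /amp => a1 a2 r1 r2.
apply: (lop_stable_space w2 w2') => //.
- by apply: a1; rewrite invr_gt0.
- by rewrite mul0r add0r.
- by rewrite mul0r sub0r; move: r1; case: (omega 3^-1 1 zeta) => p q /=; lra.
- move: r2; case: (omega _ _ zeta) => p q; case: (zeta) x0 => [[x y] xi] /= x0.
  by nra.
- move: r2; case: (omega _ _ zeta) => p q; case: (zeta) x0 => [[x y] xi] /= x0.
  by nra.
Qed.

(** For u < 0 the shock block has no eigenvalue a with Re a > 0: the equation would
    be (a - tau/u)(a + tau) = xi^2/u, where both factors have positive real
    part and the product is real and nonpositive. *)
Lemma unstable_space_ex (U : 'rV[R]_4) zeta : U 0 i0 < 0 -> 0 < complex.Re zeta.1 ->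
  unstable_space (lopatinski_matrix exF1 exF2 U zeta) = <<[:: wave_unstable zeta]>>%VS.
Proof.
move=> u0 x0; rewrite lopatinski_matrix_blk ?lt_eqF //.
have v0 : (U 0 i0)^-1 < 0 by rewrite invr_lt0.
move: (U 0 i0)^-1 v0 => v v0.
have w2' := omega3_sqr (ltW x0).
have r1 := Re_omega3 x0; have a1 : amp 3^-1 1 zeta != 0 by rewrite amp_neq0 // invr_gt0.
rewrite /wave_unstable -[X in col4 0 0 _ X]mul1r.
apply: (lop_unstable_space (s := ((v + 1) / 2)%:C%C) (b := v%:C%C) w2') => //.
- by rewrite mul0r add0r.
- by rewrite mul0r sub0r; move: r1; case: (omega 3^-1 1 zeta) => p q /=; lra.
move=> [a1' a2]; case: (zeta) x0 => [[x y] xi] /= x0 a0.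
apply/eqP; rewrite expr2; simpc => -[].
have -> : (v + 1) / 2 + (v - 1) / 2 = v by field.
have -> : (v + 1) / 2 - (v - 1) / 2 = 1 by field.
rewrite !mul1r; have p0 : 0 < a1' - v * x by nra.
have q0 : 0 < a1' + x by lra.
(* The factors are p + ip' and q + iq', the product being v xi^2 with v = 1/u. *)
move: p0 q0 (a2 - v * y) (a2 + y); move: (a1' - v * x) (a1' + x).
move=> p q p0 q0 p' q' h1 h2.
have h3 : p * (q ^+ 2 + q' ^+ 2) = v * (xi * xi) * q.
  have -> : p * (q ^+ 2 + q' ^+ 2) =
    q * (p * q - p' * q') + q' * (p * q' + p' * q) by ring.
  by rewrite h2 mulr0 addr0 mulrC; congr (_ * _); lra.
have h4 : 0 < p * (q ^+ 2 + q' ^+ 2).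
  by rewrite mulr_gt0 // ltr_wpDr ?sqr_ge0 // exprn_gt0.
have h5 : v * (xi * xi) * q <= 0.
  by rewrite mulr_le0_ge0 // ?(ltW q0) // mulr_le0_ge0 ?(ltW v0) // -expr2 sqr_ge0.
by rewrite -h3 in h5; lra.
Qed.

(** The normal modes do not vanish on the hemisphere, the boundary included: if
    xi = 0 then omega = s tau, so that s tau + omega = 2 s tau. *)
Lemma amp_or_xi_neq0 s b zeta : 0 < s -> hemisphere zeta -> amp s b zeta = 0 ->
  zeta.2 != 0.
Proof.
move=> s0 [x0 sph] amp0; apply/eqP => xi0.
suff /eqP : zeta.1 = 0.
  move=> /eqP t0; move: sph; rewrite xi0 t0 /= !expr0n /= !addr0 => /eqP.
  by rewrite eq_sym oner_eq0.
have : amp s b zeta = (2 * s)%:C%C * zeta.1.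
  rewrite /amp /omega xi0 mulr0 (_ : Complex 0 0 = 0 :> R[i]) // addr0 subr0 -expr2.
  rewrite half_sqrtK; last first.
    by case: (zeta.1) x0 => x y /= x0; rewrite mul0r subr0 mulr_ge0 // ltW.
  by rewrite -mulrDl -rmorphD /= mulr_natl mulr2n.
rewrite amp0 => /esym/eqP; rewrite mulf_eq0 => /orP[|/eqP->//].
by rewrite eq_complex /= mulf_eq0 pnatr_eq0 (gt_eqF s0).
Qed.

Lemma continuous_col4 (T : topologicalType) (x y z t : T -> C) :
  continuous x -> continuous y -> continuous z -> continuous t ->
  continuous (fun p => col4 (x p) (y p) (z p) (t p)).
Proof.
move=> cx cy cz ct p; apply/cvg_ballP => e e0; near=> q; split=> // i j.
move: i; elim/ord4_ind; rewrite !mxE /=; near: q.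
- by move/cvg_ballP: (cx p); apply.
- by move/cvg_ballP: (cy p); apply.
- by move/cvg_ballP: (cz p); apply.
- by move/cvg_ballP: (ct p); apply.
Unshelve. all: by end_near. Qed.

End Frames.

Section Bases.
Variable R : realType.
Local Notation C := (R[i]^o).
Implicit Types zeta : C * R.

Lemma enum_ord4 : enum 'I_4 = [:: i0; i1; i2; i3].
Proof. by apply: (inj_map val_inj); rewrite val_enum_ord. Qed.

Lemma enum_below : enum [pred j : 'I_4 | (j < i2)%N] = [:: i0; i1].
Proof. by rewrite /enum_mem -enumT enum_ord4. Qed.

Lemma enum_above : enum [pred j : 'I_4 | (i2 < j)%N] = [:: i3].
Proof. by rewrite /enum_mem -enumT enum_ord4. Qed.

Lemma free_stable k zeta : 0 < k -> hemisphere zeta ->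
  free [:: shock_stable k zeta; wave_stable zeta].
Proof.
move=> k0 hz; have s0 : 0 < (k + 1) / 2 by lra.
have frame0 (s b : R) : 0 < s ->
    ((Complex 0 zeta.2 : C) == 0) && (amp s b zeta == 0) = false.
  move=> s1; apply/negP => /andP[xi0 /eqP amp0].
  move: (amp_or_xi_neq0 s1 hz amp0); move: xi0.
  by rewrite eq_complex /= eqxx /= => ->.
rewrite free_cons seq1_free span_seq1 /shock_stable /wave_stable; apply/andP; split; last first.
  by rewrite col4_eq0 !eqxx /= frame0 // invr_gt0.
apply/negP => /vlineP[c]; rewrite scale_col4 !mulr0 => /eqP.
rewrite -subr_eq0 -scaleN1r scale_col4 add_col4 !mulr0 !addr0 col4_eq0.
by move=> /and4P[h1 h2 _ _]; have := frame0 _ (Num.sqrt k) s0; rewrite h1 h2.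
Qed.

Lemma free_wave_unstable zeta : hemisphere zeta -> free [:: wave_unstable zeta].
Proof.
move=> hz; rewrite seq1_free /wave_unstable col4_eq0 !eqxx /=; apply/negP => /andP[/eqP amp0 xi0].
have h3 : 0 < 3^-1 :> R by rewrite invr_gt0.
by move: (amp_or_xi_neq0 h3 hz amp0); move: xi0; rewrite eq_complex /= eqxx /= => ->.
Qed.

Lemma continuous_amp s b : continuous (amp s b : C * R -> C).
Proof.
apply: continuous_addC; last exact: omega_continuous.
by apply: continuous_mulC; [exact: cst_continuous|exact: continuous_tau].
Qed.

Lemma continuous_ixi : continuous (fun zeta => Complex 0 zeta.2 : C).
Proof.
suff -> : (fun zeta => Complex 0 zeta.2 : C) = fun zeta => Complex 0 (1 * zeta.2).
  exact: continuous_i_xi.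
by apply/funext => z; rewrite mul1r.
Qed.

Lemma continuous_shock_stable (k : R) : continuous (shock_stable k).
Proof.
by apply: continuous_col4; [exact: continuous_ixi|exact: continuous_amp|
  exact: cst_continuous|exact: cst_continuous].
Qed.

Lemma continuous_wave_stable : continuous (@wave_stable R).
Proof.
by apply: continuous_col4; [exact: cst_continuous|exact: cst_continuous|
  exact: continuous_ixi|exact: continuous_amp].
Qed.

Lemma continuous_wave_unstable : continuous (@wave_unstable R).
Proof.
by apply: continuous_col4; [exact: cst_continuous|exact: cst_continuous|
  exact: continuous_amp|exact: continuous_ixi].
Qed.

(** The explicit modes are a global continuous frame, so their spans are the
    continuous extensions. *)
Lemma lopatinski_bases_ex (Um Up : 'rV[R]_4) : 0 < Um 0 i0 -> Up 0 i0 < 0 ->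
  exists rm rp : 'I_4 -> C * R -> 'cV[C]_4, lopatinski_bases exF1 exF2 i2 Um Up rm rp.
Proof.
move=> um up; pose k := (Um 0 i0)^-1; have k0 : 0 < k by rewrite invr_gt0.
pose rm (j : 'I_4) := if j == i0 then shock_stable k else @wave_stable R.
exists rm, (fun _ => @wave_unstable R).
exists (fun zeta => <<[:: shock_stable k zeta; wave_stable zeta]>>%VS).
exists (fun zeta => <<[:: wave_unstable zeta]>>%VS).
have crm j : continuous (rm j).
  by rewrite /rm; case: eqP => _; [exact: continuous_shock_stable|exact: continuous_wave_stable].
have bm zeta : hemisphere zeta ->
    basis_of <<[:: shock_stable k zeta; wave_stable zeta]>>
      [:: shock_stable k zeta; wave_stable zeta].
  by move=> hz; rewrite /basis_of eqxx free_stable.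
have bp zeta : hemisphere zeta -> basis_of <<[:: wave_unstable zeta]>> [:: wave_unstable zeta].
  by move=> hz; rewrite /basis_of eqxx free_wave_unstable.
split; [split|split; [split|split; split]].
- by move=> zeta _ x0; rewrite stable_space_ex.
- move=> z0 _; exists setT, 2, (fun j : 'I_2 => rm (widen_ord (isT : 2 <= 4)%N j)).
  split=> //; first exact: openT.
  + by move=> j; apply: continuous_subspaceT.
  + move=> z hz _; rewrite enum_ordSl enum_ordSl (size0nil (size_enum_ord 0)) /= /rm.
    exact: bm.
- by move=> zeta _ x0; rewrite unstable_space_ex.
- move=> z0 _; exists setT, 1, (fun j : 'I_1 => @wave_unstable R).
  split=> //; first exact: openT.
  + by move=> j; apply: continuous_subspaceT; exact: continuous_wave_unstable.
  + by move=> z hz _; rewrite enum_ordSl (size0nil (size_enum_ord 0)) /=; exact: bp.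
- by move=> j _; exact: continuous_subspaceT.
- by move=> z hz; rewrite enum_below /= /rm; exact: bm.
- by move=> j _; apply: continuous_subspaceT; exact: continuous_wave_unstable.
- by move=> z hz; rewrite enum_above /=; exact: bp.
Qed.

End Bases.

(** * Passage to the boundary of the hemisphere *)

Section Boundary.
Variable R : realType.
Local Notation C := (R[i]^o).
Implicit Types zeta : C * R.

(** A curve on the hemisphere that leaves its boundary at (i sigma, xi) into the
    region Re tau > 0. *)
Definition inward_path (sigma xi t : R) : C * R :=
  (Complex t (Num.sqrt (1 - t ^+ 2) * sigma), xi * Num.sqrt (1 - t ^+ 2)).

Lemma inward_hemisphere sigma xi t : sigma ^+ 2 + xi ^+ 2 = 1 -> 0 < t < 1 ->
  hemisphere (inward_path sigma xi t).
Proof.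
move=> sph /andP[t0 t1]; split=> /=; first exact: ltW.
have r2 : Num.sqrt (1 - t ^+ 2) ^+ 2 = 1 - t ^+ 2 by rewrite sqr_sqrtr //; nra.
rewrite !exprMn r2.
transitivity (t ^+ 2 + (1 - t ^+ 2) * (sigma ^+ 2 + xi ^+ 2)); first by ring.
by rewrite sph; ring.
Qed.

Lemma near_inward : \forall t \near (0 : R)^'+, 0 < t < 1.
Proof.
near=> t; apply/andP; split; near: t; first exact: nbhs_right_gt.
exact: nbhs_right_lt.
Unshelve. all: by end_near. Qed.

Lemma inward_path_cvg sigma xi :
  inward_path sigma xi t @[t --> (0 : R)^'+] --> ((Complex 0 sigma : C), xi).
Proof.
have cs : continuous (fun t : R => Num.sqrt (1 - t ^+ 2)).
  have cq : continuous (fun t : R => 1 - t ^+ 2).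
    by move=> t; exact: (cvgB (cvg_cst (1 : R)) (@exprn_continuous _ 2 t)).
  by move=> t; exact: (continuous_comp (cq t) (@sqrt_continuous R _)).
have cr : Num.sqrt (1 - t ^+ 2) @[t --> (0 : R)^'+] --> (1 : R).
  by have := cvg_at_right_filter (cs 0); rewrite expr0n subr0 sqrtr1.
have c2 : xi * Num.sqrt (1 - t ^+ 2) @[t --> (0 : R)^'+] --> xi.
  by rewrite -[X in _ --> X]mulr1; exact: (cvgM (cvg_cst xi) cr).
have ccr := continuous_cvg _ (@continuous_real_complex R 1) cr.
have c0 := cvg_at_right_filter (@continuous_real_complex R 0).
have c1 : (Complex t (Num.sqrt (1 - t ^+ 2) * sigma) : C) @[t --> (0 : R)^'+] -->
    (Complex 0 sigma : C).
  have -> : (fun t : R => Complex t (Num.sqrt (1 - t ^+ 2) * sigma) : C) =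
    (fun t => (t%:C%C : C) + (Complex 0 sigma : C) * ((Num.sqrt (1 - t ^+ 2))%:C%C : C)).
    by apply/funext => t; simpc; rewrite mulrC.
  have e : (Complex 0 sigma : C) =
      ((0 : R)%:C%C : C) + (Complex 0 sigma : C) * ((1 : R)%:C%C : C).
    by simpc.
  rewrite [X in _ --> X]e; apply: cvg_addC; first exact: c0.
  by apply: cvg_mulC; [exact: cvg_cst|exact: ccr].
exact: (cvg_pair c1 c2).
Qed.

Lemma cvg_inward (V : topologicalType) (r : C * R -> V) sigma xi :
  sigma ^+ 2 + xi ^+ 2 = 1 -> {within @hemisphere R, continuous r} ->
  r (inward_path sigma xi t) @[t --> (0 : R)^'+] --> r ((Complex 0 sigma : C), xi).
Proof.
move=> sph /subspace_continuousP cr.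
have hz : hemisphere ((Complex 0 sigma : C), xi) by split=> //=; rewrite expr0n add0r.
apply: cvg_trans (cr _ hz) => A /= rA.
have h := @inward_path_cvg sigma xi _ rA.
move: near_inward h; apply: filterS2 => t t01; apply.
exact: inward_hemisphere.
Qed.

Lemma cvg_det (F : set_system R) (FF : Filter F) n
    (f : 'I_n -> 'I_n -> R -> C) (l : 'I_n -> 'I_n -> C) :
  (forall i j, f i j t @[t --> F] --> l i j) ->
  (\det (\matrix_(i, j) f i j t) : C) @[t --> F] --> (\det (\matrix_(i, j) l i j) : C).
Proof.
move=> fl; rewrite /determinant.
apply: cvg_big; first exact: add_continuous.
move=> s _; apply: cvgM; first exact: cvg_cst.
apply: cvg_big; first exact: mul_continuous.
move=> i _; rewrite mxE; under eq_cvg do rewrite mxE; exact: fl.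
Qed.

Lemma limit_eq0 (f : R -> C) (l : C) : (forall t, 0 < t < 1 -> f t = 0) ->
  f t @[t --> (0 : R)^'+] --> l -> l = 0.
Proof.
move=> f0 fl; have c0 : f t @[t --> (0 : R)^'+] --> (0 : C).
  have : (fun _ : R => 0 : C) @ (0 : R)^'+ --> (0 : C) by exact: cvg_cst.
  apply: cvg_trans; apply: near_eq_cvg.
  by apply: filterS near_inward => t ht; rewrite f0.
by apply: (cvg_unique _ fl c0); exact: norm_hausdorff.
Qed.

End Boundary.

(** * The determinant at the glancing frequency *)

Section Vanishing.
Variable R : realType.
Local Notation C := (R[i]^o).
Implicit Types zeta : C * R.

Definition cols4 (a b c d : 'cV[C]_4) : 'M[C]_4 :=
  \matrix_(i, j) ([:: a; b; c; d]`_j) i 0.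

Lemma det_cols4_dependent (a b c : 'cV[C]_4) (x y : C) :
  \det (cols4 a b c (x *: a + y *: b)) = 0.
Proof.
apply/eqP; rewrite -det_tr; apply/det0P.
exists (\row_j [:: x; y; 0; -1]`_j).
  by apply/eqP => /matrixP/(_ 0 i3); rewrite !mxE /= => /eqP; rewrite oppr_eq0 oner_eq0.
apply/matrixP => i j; rewrite !mxE sum_ord4 !mxE /= ?mxE; ring.
Qed.

Lemma det_cols4_scale (a b c d : 'cV[C]_4) (k : C) :
  \det (cols4 a b c (k *: d)) = k * \det (cols4 a b c d).
Proof.
have -> : cols4 a b c (k *: d) = cols4 a b c d *m blk 1 0 0 1 1 0 0 k.
  apply/matrixP => i; elim/ord4_ind; rewrite !mxE sum_ord4 !mxE /= ?mxE; ring.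
by rewrite det_mulmx det_blk mulrC; congr (_ * _); ring.
Qed.

Lemma lopatinski_det_cols F2 (Um Up : 'rV[R]_4) rm rp zeta :
  lopatinski_det F2 i2 Um Up rm rp zeta =
  \det (cols4 (rm i0 zeta) (rm i1 zeta) (lopatinski_jump F2 Um Up zeta) (rp i3 zeta)).
Proof.
by congr (\det _); apply/matrixP => i; elim/ord4_ind; rewrite !mxE.
Qed.

Lemma cvg_entry (F : set_system R) (FF : Filter F) n
    (f : R -> 'cV[C]_n) (l : 'cV[C]_n) i :
  f t @[t --> F] --> l -> f t i 0 @[t --> F] --> l i 0.
Proof. by move=> fl; exact: (continuous_cvg _ (@coord_continuous _ _ _ i 0 l) fl). Qed.

Lemma cvg_det_cols4 (F : set_system R) (FF : Filter F) (a b c d : R -> 'cV[C]_4)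
    (a' b' c' d' : 'cV[C]_4) :
  a t @[t --> F] --> a' -> b t @[t --> F] --> b' ->
  c t @[t --> F] --> c' -> d t @[t --> F] --> d' ->
  (\det (cols4 (a t) (b t) (c t) (d t)) : C) @[t --> F] --> (\det (cols4 a' b' c' d') : C).
Proof.
move=> ca cb cc cd.
apply: (@cvg_det R F FF 4 (fun i j t => ([:: a t; b t; c t; d t]`_j) i 0)
  (fun i j => ([:: a'; b'; c'; d']`_j) i 0)) => i.
by elim/ord4_ind => /=; exact: cvg_entry.
Qed.

Section Limit.
Variables (Um Up : 'rV[R]_4) (rm rp : 'I_4 -> C * R -> 'cV[C]_4) (sigma xi : R).
Hypotheses (um0 : 0 < Um 0 i0) (up0 : Up 0 i0 < 0).
Hypothesis bases : lopatinski_bases exF1 exF2 i2 Um Up rm rp.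
Hypothesis sph : sigma ^+ 2 + xi ^+ 2 = 1.
Let z0 : C * R := (Complex 0 sigma : C, xi).

(** Where Re tau > 0 the wave mode lies in the span of the first two columns, so
    the determinant is zero, and it is continuous up to the boundary. *)
Lemma stable_limit (c : 'cV[C]_4) :
  \det (cols4 (rm i0 z0) (rm i1 z0) c (wave_stable z0)) = 0.
Proof.
have [Em [Ep [[Em_in _] [_ [[crm brm] _]]]]] := bases.
apply: (@limit_eq0 R (fun t => let z := inward_path sigma xi t in
  \det (cols4 (rm i0 z) (rm i1 z) c (wave_stable z)))).
  move=> t t01 /=; set z := inward_path _ _ _.
  have hz : hemisphere z by exact: inward_hemisphere.
  have x0 : 0 < complex.Re z.1 by case/andP: t01.
  have := brm z hz; rewrite enum_below /= => /andP[/eqP span_rm _].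
  have : wave_stable z \in Em z.
    by rewrite Em_in // stable_space_ex // memv_span // !inE eqxx orbT.
  rewrite -span_rm span_cons span_seq1 => /memv_addP[_ /vlineP[x ->] [_ /vlineP[y ->] ->]].
  exact: det_cols4_dependent.
apply: cvg_det_cols4.
- by apply: cvg_inward => //; exact: crm.
- by apply: cvg_inward => //; exact: crm.
- exact: cvg_cst.
- by apply: cvg_inward => //; apply: continuous_subspaceT; exact: continuous_wave_stable.
Qed.

(** Proportionality to the basis vector of E^+, written with the minors of size
    two so as to pass to the limit. *)
Lemma unstable_limit i j :
  wave_unstable z0 i 0 * rp i3 z0 j 0 = wave_unstable z0 j 0 * rp i3 z0 i 0.
Proof.
have [Em [Ep [_ [[Ep_in _] [_ [crp brp]]]]]] := bases.
have crp3 : rp i3 (inward_path sigma xi t) @[t --> 0^'+] --> rp i3 z0.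
  by apply: cvg_inward => //; exact: crp.
have cv : wave_unstable (inward_path sigma xi t) @[t --> 0^'+] --> wave_unstable z0.
  exact: (cvg_inward (r := @wave_unstable R) sph
    (continuous_subspaceT (@continuous_wave_unstable R))).
apply/eqP; rewrite -subr_eq0; apply/eqP.
apply: (@limit_eq0 R (fun t => let z := inward_path sigma xi t in
  wave_unstable z i 0 * rp i3 z j 0 - wave_unstable z j 0 * rp i3 z i 0)).
  move=> t t01 /=; set z := inward_path _ _ _.
  have hz : hemisphere z by exact: inward_hemisphere.
  have x0 : 0 < complex.Re z.1 by case/andP: t01.
  have := brp z hz; rewrite enum_above /= => /andP[/eqP span_rp _].
  have : wave_unstable z \in Ep z.
    by rewrite Ep_in // unstable_space_ex // memv_span // !inE eqxx.
  by rewrite -span_rp span_seq1 => /vlineP[x ->]; rewrite !mxE; ring.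
have e k l := cvg_mulC _ (@cvg_entry _ _ 4 _ _ k cv) (@cvg_entry _ _ 4 _ _ l crp3).
exact: (cvgB (e _ _ _ i j) (e _ _ _ j i)).
Qed.

(** At tau = 3 i xi one has omega = 0, and both wave modes are (i xi, i xi). *)
Lemma lopatinski_det_glancing : sigma = 3 * xi ->
  lopatinski_det exF2 i2 Um Up rm rp z0 = 0.
Proof.
move=> glancing.
have xi0 : xi != 0.
  apply/eqP => h; move: sph; rewrite glancing h mulr0 expr0n addr0 => /eqP.
  by rewrite eq_sym oner_eq0.
have amp0 : amp 3^-1 1 z0 = Complex 0 xi.
  have w0 : omega 3^-1 1 z0 = 0.
    apply/eqP; rewrite -sqrf_eq0 omega3_sqr //=; apply/eqP.
    rewrite !expr2 glancing; simpc; apply/eqP; rewrite eq_complex /= eqxx andbT.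
    by apply/eqP; field.
  rewrite /amp w0 addr0 /z0 glancing /=; simpc; apply/eqP; rewrite eq_complex /= eqxx /=.
  by apply/eqP; field.
have same : wave_unstable z0 = wave_stable z0 by rewrite /wave_unstable /wave_stable amp0.
have w_neq0 : wave_unstable z0 i3 0 != 0.
  by rewrite mxE /= eq_complex /= negb_and xi0 orbT.
have rpE : rp i3 z0 = (rp i3 z0 i3 0 / wave_unstable z0 i3 0) *: wave_stable z0.
  apply/matrixP => i j; rewrite ord1 -same mxE.
  by apply: (mulfI w_neq0); rewrite unstable_limit mulrCA mulrA divfK // mulrC.
by rewrite lopatinski_det_cols rpE det_cols4_scale stable_limit mulr0.
Qed.

End Limit.

End Vanishing.

Theorem proposition1 (R : realType) :
  exists (n : nat) (D : set 'rV[R]_n) (F1 F2 : 'rV[R]_n -> 'rV[R]_n)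
         (p : 'I_n) (Lam : 'rV[R]_n -> R * R -> R -> R),
    (2 <= n)%N /\ open D /\ smooth_on D F1 /\ smooth_on D F2 /\
    symmetric_system F1 F2 D /\
    constant_multiplicity_hyperbolic F1 F2 D /\
    simple_mode F1 F2 D p Lam /\
    Metivier_convex F1 F2 D Lam /\
    exists (Ustar : 'rV[R]_n) (eps : R),
      D Ustar /\ Lam Ustar (1, 0) 0 = 0 /\ 0 < eps /\
      forall Um Up : 'rV[R]_n,
        laxian_shock F1 D p Um Up ->
        `|Um - Ustar| < eps -> `|Up - Ustar| < eps ->
        (exists rm rp : 'I_n -> R[i]^o * R -> 'cV[R[i]^o]_n,
           lopatinski_bases F1 F2 p Um Up rm rp) /\
        (forall rm rp : 'I_n -> R[i]^o * R -> 'cV[R[i]^o]_n,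
           lopatinski_bases F1 F2 p Um Up rm rp ->
           exists sigma xi : R, sigma ^+ 2 + xi ^+ 2 = 1 /\
             lopatinski_det F2 p Um Up rm rp (Complex 0 sigma, xi) = 0).
Proof.
exists 4, exD, exF1, exF2, i2, (@exLam R).
have D0 : exD (0 : 'rV[R]_4) by rewrite /exD /= mxE ltrN10 ltr01.
split=> //; split; first exact: exD_open.
split; first exact/smooth_exF1/exD_open.
split; first exact/smooth_exF2/exD_open.
split; first exact: symmetric_ex.
split; first exact: hyperbolic_ex.
split; first exact: simple_mode_ex.
split; first exact: Metivier_convex_ex.
exists 0, 1; split=> //; split; first by rewrite (exLam_e1 D0) mxE.
split=> // Um Up /laxian_shock_ex[/andP[um _] /andP[_ up]] _ _.
split; first exact: lopatinski_bases_ex.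
move=> rm rp bases; exists (3 * (Num.sqrt 10)^-1), (Num.sqrt 10)^-1.
have sph : (3 * (Num.sqrt 10)^-1) ^+ 2 + (Num.sqrt 10)^-1 ^+ 2 = 1 :> R.
  by rewrite exprMn exprVn sqr_sqrtr //; field.
by split=> //; exact: (lopatinski_det_glancing um up bases sph).
Qed.
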